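(* A 4-dimensional Riemannian manifold $M=(M,g)$ is weakly Einstein if and only if there exists a generalized Singer-Thorpe basis of $T_pM$ at each point $p\in M$.
   Context: Let $M=(M,g)$ be a 4-dimensional Riemannian manifold with Levi-Civita connection $\nabla$. The curvature tensor is $R(X,Y)Z=[\nabla_X,\nabla_Y]Z-\nabla_{[X,Y]}Z$. For an orthonormal basis $\{e_i\}$ ($1\le i\le 4$) of $T_pM$, write $R_{ijkl}=g(R(e_i,e_j)e_k,e_l)$, and $|R|^2=\sum_{i,j,k,l}R_{ijkl}^2$. $M$ is called weakly Einstein if at every point $p\in M$, with respect to an orthonormal basis of $T_pM$ (equivalently, any orthonormal basis), $$\sum_{a,b,c=1}^4 R_{abci}R_{abcj}=\frac14|R|^2\delta_{ij}\qquad(1\le i,j\le 4),$$ where $|R|^2$ is a function on $M$ that is not required to be constant. An orthonormal basis $\{e_i\}$ of $T_pM$ is called a generalized Singer-Thorpe basis of $T_pM$ if $$R_{ijjk}=0\quad\text{for all } 1\le i,j,k\le 4 \text{ with } i\neq k$$ (no summation over $j$), and $$R_{1212}^2=R_{3434}^2,\qquad R_{1313}^2=R_{2424}^2,\qquad R_{1414}^2=R_{2323}^2.$$ *)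

(* Defs.v *)
From HB Require Import structures.
From mathcomp Require Import all_boot all_order all_algebra.
From mathcomp Require Import all_classical all_reals all_analysis.
From mathcomp Require Import ring.
Import Order.TTheory GRing.Theory Num.Theory.
Import numFieldNormedType.Exports.

Set Implicit Arguments.
Unset Strict Implicit.
Unset Printing Implicit Defensive.

Local Open Scope classical_set_scope.
Local Open Scope ring_scope.

Definition pderiv (R : realType) (n : nat) (i : 'I_n) (f : 'rV[R]_n -> R) :
  'rV[R]_n -> R := fun x => 'D_(delta_mx 0 i) f x.

Definition smooth_on (R : realType) (n : nat) (U : set 'rV[R]_n)
    (f : 'rV[R]_n -> R) : Prop :=
  forall (s : seq 'I_n) (x : 'rV[R]_n), U x ->
    {for x, continuous (foldr (@pderiv R n) f s)} /\
    (forall i : 'I_n,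
       derivable (foldr (@pderiv R n) f s) x (delta_mx 0 i : 'rV[R]_n)).

(* [chart_fun] and [chart_inv] are only meaningful on [chart_dom] and on its
   image; their values elsewhere are unconstrained. *)
Record chart (R : realType) (n : nat) (T : topologicalType) := Chart {
  chart_dom : set T ;
  chart_fun :> T -> 'rV[R]_n ;
  chart_inv : 'rV[R]_n -> T ;
  chart_dom_open : open chart_dom ;
  chart_img_open : open (chart_fun @` chart_dom) ;
  chart_funK : forall p : T, chart_dom p -> chart_inv (chart_fun p) = p ;
  chart_fun_continuous : {within chart_dom, continuous chart_fun} ;
  chart_inv_continuous :
    {within chart_fun @` chart_dom, continuous chart_inv} }.

Definition transition (R : realType) (n : nat) (T : topologicalType)
    (a b : chart R n T) : 'rV[R]_n -> 'rV[R]_n :=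
  fun x => b (chart_inv a x).

(* [chart_at p] is a chosen chart around p; it serves to coordinatize the
   tangent space at p. *)
Record smoothManifold (R : realType) (n : nat) := SmoothManifold {
  carrier :> topologicalType ;
  carrier_hausdorff : hausdorff_space carrier ;
  carrier_second_countable : @second_countable carrier ;
  atlas : set (chart R n carrier) ;
  chart_at : carrier -> chart R n carrier ;
  chart_at_atlas : forall p : carrier, atlas (chart_at p) ;
  chart_at_dom : forall p : carrier, chart_dom (chart_at p) p ;
  transition_smooth : forall a b : chart R n carrier, atlas a -> atlas b ->
    forall k : 'I_n,
      smooth_on (a @` (chart_dom a `&` chart_dom b))
                (fun x => transition a b x 0 k) }.

(* [metric a x] is the Gram matrix, at the point with coordinates x, of the
   coordinate frame of the chart a.  With the row-vector convention
   'D_v f x = v *m 'J f x, [metric_transition] is the transformation rule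
   making these matrices the components of one (0,2)-tensor field. *)
Record riemannianManifold (R : realType) (n : nat) := RiemannianManifold {
  base :> smoothManifold R n ;
  metric : chart R n base -> 'rV[R]_n -> 'M[R]_n ;
  metric_smooth : forall a : chart R n base, atlas a ->
    forall i j : 'I_n, smooth_on (a @` chart_dom a) (fun x => metric a x i j) ;
  metric_sym : forall a : chart R n base, atlas a ->
    forall p : base, chart_dom a p -> (metric a (a p))^T = metric a (a p) ;
  metric_posdef : forall a : chart R n base, atlas a ->
    forall p : base, chart_dom a p ->
    forall v : 'rV[R]_n, v != 0 -> 0 < (v *m metric a (a p) *m v^T) 0 0 ;
  metric_transition : forall a b : chart R n base, atlas a -> atlas b ->
    forall p : base, chart_dom a p -> chart_dom b p ->
    metric a (a p) =
      'J (transition a b) (a p) *m metric b (b p)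
        *m ('J (transition a b) (a p))^T }.

(* In what follows G is the matrix of the metric in a chart, and vector fields
   on the chart are given by their components in the coordinate frame. *)

Definition lie_bracket (R : realType) (n : nat) (X Y : 'rV[R]_n -> 'rV[R]_n) :
    'rV[R]_n -> 'rV[R]_n :=
  fun x => \row_k \sum_(i < n)
    (X x 0 i * pderiv i (fun y => Y y 0 k) x -
     Y x 0 i * pderiv i (fun y => X y 0 k) x).

Definition christoffel (R : realType) (n : nat) (G : 'rV[R]_n -> 'M[R]_n)
    (k i j : 'I_n) : 'rV[R]_n -> R :=
  fun x => 2^-1 * \sum_(l < n) invmx (G x) k l *
    (pderiv i (fun y => G y j l) x + pderiv j (fun y => G y i l) x -
     pderiv l (fun y => G y i j) x).

(* [cov_deriv_torsion_free] and [cov_deriv_metric] below show that this is the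
   Levi-Civita connection of G. *)
Definition cov_deriv (R : realType) (n : nat) (G : 'rV[R]_n -> 'M[R]_n)
    (X Y : 'rV[R]_n -> 'rV[R]_n) : 'rV[R]_n -> 'rV[R]_n :=
  fun x => \row_k
    (\sum_(i < n) X x 0 i * pderiv i (fun y => Y y 0 k) x +
     \sum_(i < n) \sum_(j < n) christoffel G k i j x * X x 0 i * Y x 0 j).

Lemma christoffel_lower (R : realType) (n : nat) (G : 'rV[R]_n -> 'M[R]_n)
    (x : 'rV[R]_n) (i j l : 'I_n) :
  (G x)^T = G x -> G x \in unitmx ->
  \sum_(k < n) christoffel G k i j x * G x k l =
  2^-1 * (pderiv i (fun y => G y j l) x + pderiv j (fun y => G y i l) x -
          pderiv l (fun y => G y i j) x).
Proof.
move=> Gs Gu; pose T m : R :=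
  pderiv i (fun y => G y j m) x + pderiv j (fun y => G y i m) x -
  pderiv m (fun y => G y i j) x.
have E k : christoffel G k i j x * G x k l =
    \sum_(m < n) 2^-1 * (T m * (G x l k * invmx (G x) k m)).
  rewrite /christoffel -{2}Gs mxE -mulrA -big_distrr /=; congr (_ * _).
  rewrite big_distrl /=; apply: eq_bigr => m _; rewrite -/(T m).
  ring.
rewrite (eq_bigr _ (fun k _ => E k)) exchange_big /=.
have F m : \sum_(k < n) 2^-1 * (T m * (G x l k * invmx (G x) k m)) =
    2^-1 * (T m * (l == m)%:R).
  rewrite -!big_distrr /=; congr (_ * (_ * _)).
  by have /matrixP/(_ l m) := mulmxV Gu; rewrite !mxE.
rewrite (eq_bigr _ (fun m _ => F m)) (bigD1 l) //= eqxx mulr1.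
by rewrite big1 ?addr0 // => m; rewrite eq_sym => /negbTE ->; rewrite !mulr0.
Qed.

Lemma pderiv_sym (R : realType) (n : nat) (G : 'rV[R]_n -> 'M[R]_n)
    (x : 'rV[R]_n) (i j k : 'I_n) :
  (\forall y \near x, (G y)^T = G y) ->
  pderiv k (fun y => G y i j) x = pderiv k (fun y => G y j i) x.
Proof.
move=> Gs; apply: near_eq_derive; near=> y.
by rewrite -[in LHS](near Gs y) ?mxE.
Unshelve. all: by end_near. Qed.

Lemma christoffel_sym (R : realType) (n : nat) (G : 'rV[R]_n -> 'M[R]_n)
    (x : 'rV[R]_n) (k i j : 'I_n) :
  (\forall y \near x, (G y)^T = G y) ->
  christoffel G k i j x = christoffel G k j i x.
Proof.
move=> Gs; congr (_ * _); apply: eq_bigr => l _.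
by rewrite (pderiv_sym i j l Gs) [in LHS](addrC (pderiv i _ x)).
Qed.

Lemma cov_deriv_torsion_free (R : realType) (n : nat)
    (G : 'rV[R]_n -> 'M[R]_n) (X Y : 'rV[R]_n -> 'rV[R]_n) (x : 'rV[R]_n) :
  (\forall y \near x, (G y)^T = G y) ->
  cov_deriv G X Y x - cov_deriv G Y X x = lie_bracket X Y x.
Proof.
move=> Gs; apply/rowP => k; rewrite !mxE opprD addrACA -sumrB.
rewrite [X in _ + (_ - X)]exchange_big -sumrB [X in _ + X]big1 ?addr0 // => i _.
rewrite -sumrB big1 // => j _ /=; rewrite (christoffel_sym k j i Gs); ring.
Qed.

Lemma cov_deriv_metric (R : realType) (n : nat)
    (G : 'rV[R]_n -> 'M[R]_n) (X Y Z : 'rV[R]_n -> 'rV[R]_n) (x : 'rV[R]_n) :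
  (\forall y \near x, (G y)^T = G y) -> G x \in unitmx ->
  (forall i j k : 'I_n,
     derivable (fun y => G y i j) x (delta_mx 0 k : 'rV[R]_n)) ->
  (forall i k : 'I_n,
     derivable (fun y => X y 0 i) x (delta_mx 0 k : 'rV[R]_n)) ->
  (forall i k : 'I_n,
     derivable (fun y => Y y 0 i) x (delta_mx 0 k : 'rV[R]_n)) ->
  \sum_(i < n) Z x 0 i *
     pderiv i (fun y => (X y *m G y *m (Y y)^T) 0 0) x =
  (cov_deriv G Z X x *m G x *m (Y x)^T) 0 0 +
  (X x *m G x *m (cov_deriv G Z Y x)^T) 0 0.
Proof.
move=> Gs Gu dG dX dY; have Gsx : (G x)^T = G x by exact: nbhs_singleton Gs.
pose f k l := ((fun y => X y 0 k) * (fun y => G y k l)) * (fun y => Y y 0 l).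
have E i : pderiv i (fun y => (X y *m G y *m (Y y)^T) 0 0) x =
   \sum_(l < n) \sum_(k < n)
     (X x 0 k * G x k l * pderiv i (fun y => Y y 0 l) x +
      Y x 0 l * (X x 0 k * pderiv i (fun y => G y k l) x +
                 G x k l * pderiv i (fun y => X y 0 k) x)).
  have -> : (fun y => (X y *m G y *m (Y y)^T) 0 0) =
            \sum_(l < n) \sum_(k < n) f k l.
    apply/funext => y; rewrite !mxE fct_sumE; apply: eq_bigr => l _.
    by rewrite !mxE fct_sumE big_distrl.
  have df k l : is_derive x (delta_mx 0 i : 'rV[R]_n) (f k l)
     (X x 0 k * G x k l * pderiv i (fun y => Y y 0 l) x +
      Y x 0 l * (X x 0 k * pderiv i (fun y => G y k l) x +
                 G x k l * pderiv i (fun y => X y 0 k) x)).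
    apply: is_deriveM; last exact: derivableP.
    by apply: is_deriveM; exact: derivableP.
  rewrite /pderiv; apply: (@derive_val _ _ _ _ _ _ _).
rewrite (eq_bigr _ (fun i _ => congr1 (fun t => Z x 0 i * t) (E i))).
pose L i j l := \sum_(k < n) christoffel G k i j x * G x k l.
have LE i k l : L i k l + L i l k = pderiv i (fun y => G y k l) x.
  rewrite /L !christoffel_lower // -mulrDr.
  rewrite (pderiv_sym l k i Gs) (pderiv_sym i l k Gs) (pderiv_sym i k l Gs).
  by field.
have cE A k : cov_deriv G Z A x 0 k =
    \sum_(i < n) Z x 0 i * pderiv i (fun y => A y 0 k) x +
    \sum_(i < n) \sum_(j < n) christoffel G k i j x * Z x 0 i * A x 0 j.
  by rewrite mxE.
have S1 (A B : 'rV[R]_n -> 'rV[R]_n) :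
    (cov_deriv G Z A x *m G x *m (B x)^T) 0 0 =
  \sum_(i < n) Z x 0 i * \sum_(l < n) \sum_(k < n)
    (B x 0 l * (G x k l * pderiv i (fun y => A y 0 k) x)
     + A x 0 k * B x 0 l * L i k l).
  under [RHS]eq_bigr do rewrite big_distrr /=.
  rewrite exchange_big mxE; apply: eq_bigr => l _ /=.
  rewrite [(_ *m G x) _ _]mxE [(_^T) _ _]mxE.
  under [X in X * _ = _]eq_bigr do rewrite cE mulrDl; rewrite big_split mulrDl /=.
  under [RHS]eq_bigr do rewrite big_split mulrDr /=; rewrite big_split /=.
  congr (_ + _).
    rewrite big_distrl; under [RHS]eq_bigr do rewrite big_distrr /=.
    rewrite exchange_big; apply: eq_bigr => k _ /=.
    rewrite !big_distrl; apply: eq_bigr => i _ /=; ring.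
  under eq_bigr do rewrite big_distrl /=; rewrite exchange_big big_distrl /=.
  apply: eq_bigr => i _.
  under eq_bigr do rewrite big_distrl /=.
  rewrite exchange_big big_distrl big_distrr; apply: eq_bigr => k _ /=.
  rewrite /L !big_distrr big_distrl /=; apply: eq_bigr => m _; ring.
have S2 : (X x *m G x *m (cov_deriv G Z Y x)^T) 0 0 =
  \sum_(i < n) Z x 0 i * \sum_(l < n) \sum_(k < n)
    (X x 0 k * G x k l * pderiv i (fun y => Y y 0 l) x
     + X x 0 k * Y x 0 l * L i l k).
  have -> : (X x *m G x *m (cov_deriv G Z Y x)^T) 0 0 =
            (cov_deriv G Z Y x *m G x *m (X x)^T) 0 0.
    rewrite [LHS](_ : _ = ((X x *m G x *m (cov_deriv G Z Y x)^T)^T) 0 0); last by rewrite [RHS]mxE.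
    rewrite !trmx_mul trmxK Gsx mulmxA //.
  rewrite S1; apply: eq_bigr => i _; congr (_ * _).
  rewrite exchange_big; apply: eq_bigr => k _; apply: eq_bigr => l _ /=.
  by rewrite -[in LHS]Gsx mxE; ring.
rewrite S1 S2 -big_split; apply: eq_bigr => i _ /=.
rewrite -mulrDr; congr (_ * _); rewrite -big_split; apply: eq_bigr => l _ /=.
rewrite -big_split; apply: eq_bigr => k _ /=; rewrite -LE; ring.
Qed.

Definition curvature_op (R : realType) (n : nat) (G : 'rV[R]_n -> 'M[R]_n)
    (X Y Z : 'rV[R]_n -> 'rV[R]_n) : 'rV[R]_n -> 'rV[R]_n :=
  fun x => cov_deriv G X (cov_deriv G Y Z) x
         - cov_deriv G Y (cov_deriv G X Z) x
         - cov_deriv G (lie_bracket X Y) Z x.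

(* A tangent vector at p is given by its components in the coordinate frame of
   [chart_at p]. *)
Definition tangent (R : realType) (n : nat) (M : riemannianManifold R n)
  (p : M) : Type := 'rV[R]_n.

Definition inner (R : realType) (n : nat) (M : riemannianManifold R n) (p : M)
    (u v : tangent p) : R :=
  (u *m metric (chart_at p) (chart_at p p) *m v^T) 0 0.

(* R(u,v)w is tensorial, so it can be computed from any extension of u, v, w
   to vector fields near p; here the extension has constant components. *)
Definition curvature (R : realType) (n : nat) (M : riemannianManifold R n)
    (p : M) (u v w : tangent p) : tangent p :=
  curvature_op (metric (chart_at p)) (fun=> u) (fun=> v) (fun=> w)
    (chart_at p p).

(* n orthonormal vectors in a space of dimension n form a basis. *)
Definition orthonormal_basis (R : realType) (n : nat)
    (M : riemannianManifold R n) (p : M) (e : 'I_n -> tangent p) : Prop :=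
  forall i j : 'I_n, inner (e i) (e j) = (i == j)%:R.

Definition Rcomp (R : realType) (n : nat) (M : riemannianManifold R n) (p : M)
    (e : 'I_n -> tangent p) (i j k l : 'I_n) : R :=
  inner (curvature (e i) (e j) (e k)) (e l).

Definition Rnorm2 (R : realType) (n : nat) (M : riemannianManifold R n) (p : M)
    (e : 'I_n -> tangent p) : R :=
  \sum_(i < n) \sum_(j < n) \sum_(k < n) \sum_(l < n) Rcomp e i j k l ^+ 2.

Definition weakly_einstein (R : realType) (M : riemannianManifold R 4) : Prop :=
  forall p : M, exists e : 'I_4 -> tangent p, orthonormal_basis e /\
    forall i j : 'I_4,
      \sum_(a < 4) \sum_(b < 4) \sum_(c < 4)
         Rcomp e a b c i * Rcomp e a b c j
      = 4^-1 * Rnorm2 e * (i == j)%:R.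

(* The usual indices 1, 2, 3, 4 are 0, 1, 2, 3 : 'I_4. *)
Definition generalized_singer_thorpe (R : realType)
    (M : riemannianManifold R 4) (p : M) (e : 'I_4 -> tangent p) : Prop :=
  [/\ orthonormal_basis e,
      forall i j k : 'I_4, i != k -> Rcomp e i j j k = 0,
      Rcomp e 0 1 0 1 ^+ 2 = Rcomp e 2 3 2 3 ^+ 2,
      Rcomp e 0 2 0 2 ^+ 2 = Rcomp e 1 3 1 3 ^+ 2 &
      Rcomp e 0 3 0 3 ^+ 2 = Rcomp e 1 2 1 2 ^+ 2].

(* Main.v *)
Require Import Defs.
From mathcomp Require Import all_boot all_order all_algebra.
From mathcomp Require Import all_classical all_reals all_analysis.
From mathcomp Require Import ring lra.
Import Order.TTheory GRing.Theory Num.Theory.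
Import numFieldNormedType.Exports.

Set Implicit Arguments.
Unset Strict Implicit.
Unset Printing Implicit Defensive.

Local Open Scope classical_set_scope.
Local Open Scope ring_scope.

(** Fix a point and an orthonormal basis of its tangent space.  The curvature
    is a symmetric bilinear form on bivectors, and the splitting of bivectors
    into self-dual and anti-self-dual ones writes it as a symmetric matrix with
    3 x 3 blocks A, B, B^T, D (A and D on the diagonal).  Both conditions of
    the theorem are conditions on these blocks.

    - The contraction of R_abci R_abcj over a, b, c is a Ricci contraction of
      the square of this operator.  Symmetric traceless 2-tensors correspond to
      the off-diagonal block of operators on bivectors, so this contraction is
      pure trace exactly when the off-diagonal block A B + B D of the square
      vanishes ([ricci2_pure_trace]).
    - The components R_ijjk with i <> k couple two coordinate planes that share
      one axis.  They all vanish exactly when A, B and D are diagonal; the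
      diagonal entries of A B + B D are then twice the differences
      R_1212^2 - R_3434^2, and so on ([singer_thorpe_blocks]).

    Hence a generalized Singer-Thorpe basis gives A B + B D = 0.  Conversely,
    A B = - B D makes A commute with B B^T and D with B^T B.  A common unit
    eigenvector u of A and B B^T is carried by B to a multiple of an eigenvector
    of D; splitting such pairs off one at a time yields orthogonal P and Q such
    that P A P^T, P B Q^T and Q D Q^T are all diagonal
    ([simultaneous_diagonalization]).  In dimension 3 the signs of P and Q can
    be chosen so that both are rotations, and every pair of rotations of the
    self-dual and anti-self-dual bivectors comes from a rotation of the tangent
    space ([so3_pair_lift]).  That rotation produces the required basis.

    The argument needs the pair symmetry and the antisymmetries of the
    curvature.  They are read off the coordinate formula [riemannE], using the
    symmetry of second partial derivatives ([pderiv_comm]). *)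

(** * Euclidean inner product on row vectors *)

Definition dot (R : pzRingType) (n : nat) (u v : 'rV[R]_n) : R :=
  (u *m v^T) 0 0.

Lemma dotE (R : pzRingType) (n : nat) (u v : 'rV[R]_n) :
  dot u v = \sum_i u 0 i * v 0 i.
Proof. by rewrite /dot mxE; apply: eq_bigr => i _; rewrite mxE. Qed.

Lemma dotC (R : comPzRingType) (n : nat) (u v : 'rV[R]_n) : dot u v = dot v u.
Proof. by rewrite !dotE; apply: eq_bigr => i _; rewrite mulrC. Qed.

Lemma dotDl (R : comPzRingType) (n : nat) (u v w : 'rV[R]_n) :
  dot (u + v) w = dot u w + dot v w.
Proof. by rewrite /dot mulmxDl mxE. Qed.

Lemma dotZl (R : comPzRingType) (n : nat) (a : R) (u v : 'rV[R]_n) :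
  dot (a *: u) v = a * dot u v.
Proof. by rewrite /dot -scalemxAl mxE. Qed.

Lemma dotNl (R : comPzRingType) (n : nat) (u v : 'rV[R]_n) :
  dot (- u) v = - dot u v.
Proof. by rewrite /dot mulNmx mxE. Qed.

Lemma dotDr (R : comPzRingType) (n : nat) (u v w : 'rV[R]_n) :
  dot w (u + v) = dot w u + dot w v.
Proof. by rewrite dotC dotDl !(dotC w). Qed.

Lemma dotZr (R : comPzRingType) (n : nat) (a : R) (u v : 'rV[R]_n) :
  dot u (a *: v) = a * dot u v.
Proof. by rewrite dotC dotZl dotC. Qed.

Lemma dotNr (R : comPzRingType) (n : nat) (u v : 'rV[R]_n) :
  dot u (- v) = - dot u v.
Proof. by rewrite dotC dotNl dotC. Qed.

Lemma dot_ge0 (R : realType) (n : nat) (u : 'rV[R]_n) : 0 <= dot u u.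
Proof. by rewrite dotE sumr_ge0 // => i _; rewrite -expr2 sqr_ge0. Qed.

Lemma dot_eq0 (R : realType) (n : nat) (u : 'rV[R]_n) :
  (dot u u == 0) = (u == 0).
Proof.
apply/eqP/eqP => [|->]; last by rewrite /dot mul0mx mxE.
rewrite dotE => /eqP; rewrite psumr_eq0 => [/allP u0|i _]; last first.
  by rewrite -expr2 sqr_ge0.
apply/rowP => i; rewrite mxE; apply/eqP.
by have := u0 i (mem_index_enum i); rewrite /= -expr2 sqrf_eq0.
Qed.

Lemma dot_gt0 (R : realType) (n : nat) (u : 'rV[R]_n) : u != 0 -> 0 < dot u u.
Proof. by move=> u0; rewrite lt_def dot_eq0 u0 dot_ge0. Qed.

Lemma unit_scalar (R : realType) (n : nat) (u : 'rV[R]_n) :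
  u != 0 -> exists a : R, a != 0 /\ dot (a *: u) (a *: u) = 1.
Proof.
move=> u0; have d0 := dot_gt0 u0.
have s0 : Num.sqrt (dot u u) != 0 by rewrite gt_eqF // sqrtr_gt0.
exists (Num.sqrt (dot u u))^-1; split; first by rewrite invr_neq0.
rewrite dotZl dotZr -{3}(sqr_sqrtr (ltW d0)); field.
exact: s0.
Qed.

Lemma bilin_continuous (R : realType) (n : nat) (A : 'M[R]_n) :
  continuous (fun x : 'rV[R]_n => dot (x *m A) x).
Proof.
have -> : (fun x : 'rV[R]_n => dot (x *m A) x) =
          \sum_i \sum_j ((fun x : 'rV[R]_n => x 0 j) *
                         (fun=> A j i) * (fun x : 'rV[R]_n => x 0 i)).
  apply/funext => x; rewrite dotE fct_sumE; apply: eq_bigr => i _.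
  by rewrite mxE fct_sumE big_distrl.
move=> x; apply: differentiable_continuous.
apply: differentiable_sum => i; apply: differentiable_sum => j.
apply: differentiableM; last exact: differentiable_coord.
apply: differentiableM; first exact: differentiable_coord.
exact: differentiable_cst.
Qed.

Lemma dot_mulmxl (R : comPzRingType) (n m : nat) (u : 'rV[R]_n)
    (A : 'M[R]_(n, m)) (v : 'rV[R]_m) :
  dot (u *m A) v = dot u (v *m A^T).
Proof. by rewrite /dot trmx_mul trmxK mulmxA. Qed.

(** * Simultaneous diagonalization of A, B and D *)

(** On the compact set of unit vectors of the kernel of [K], the quadratic form
    of [A] attains its maximum [lam] at some [x].  Then x A - lam x is
    orthogonal to the kernel and, the kernel being stable under [A], also lies
    in it.  The subspace is presented as a kernel since the uses are to eigenspaces and to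
    the kernel of [B^T]. *)
Lemma kernel_eigenvector (R : realType) (n m : nat) (A : 'M[R]_n)
    (K : 'M[R]_(n, m)) :
  A^T = A ->
  (forall x : 'rV_n, x *m K = 0 -> x *m A *m K = 0) ->
  (exists2 x : 'rV_n, x != 0 & x *m K = 0) ->
  exists (x : 'rV_n) (a : R), [/\ x *m K = 0, dot x x = 1 & x *m A = a *: x].
Proof.
move=> As AK [y y0 yK].
pose S : set 'rV[R]_n :=
  [set x | x *m K = 0] `&` [set x | dot x x = 1].
have SE : S = (fun x : 'rV[R]_n => dot (x *m (K *m K^T)) x) @^-1` [set 0] `&`
              (fun x : 'rV[R]_n => dot (x *m 1%:M) x) @^-1` [set 1].
  apply/seteqP; split => x [] /= xK; rewrite mulmx1 => x1; split => //=.
    by rewrite mulmxA xK mul0mx /dot mul0mx mxE.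
  apply/eqP; rewrite -dot_eq0 -[K in dot _ (_ *m K)]trmxK.
  by rewrite -dot_mulmxl -mulmxA xK.
have cS : compact S.
  apply: bounded_closed_compact; last first.
    rewrite SE; apply: closedI; apply: preimage_closed.
    - by move=> x _; apply: bilin_continuous.
    - exact: closed_eq.
    - by move=> x _; apply: bilin_continuous.
    - exact: closed_eq.
  exists 1; split; first exact: num_real.
  move=> M M1 x [_ /= x1]; apply: le_trans (ltW M1).
  rewrite [leLHS](mx_normrE x); apply/bigmax_leP; split => // -[i j] _ /=.
  rewrite [i]ord1 -(@ler_pXn2r _ 2) ?nnegrE // expr1n -[leRHS]x1 dotE.
  rewrite (bigD1 j) //= real_normK ?num_real // expr2 lerDl.
  by rewrite sumr_ge0 // => k _; rewrite -expr2 sqr_ge0.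
have S0 : S !=set0.
  have [a [a0 a1]] := unit_scalar y0.
  by exists (a *: y); split => //=; rewrite -scalemxAl yK scaler0.
have [x xS xmax] := compact_EVT_max S0 cS
  (continuous_subspaceT (bilin_continuous (A := A))).
move: xS; rewrite inE => -[/= xK x1].
set lam := dot (x *m A) x in xmax *.
have mx z : z *m K = 0 -> dot (z *m A) z <= lam * dot z z.
  move=> zK; have [->|z0] := eqVneq z 0.
    by rewrite /dot !mul0mx mxE mulr0.
  have [a [a0 a1]] := unit_scalar z0.
  have : a *: z \in S.
    by rewrite inE; split => //=; rewrite -scalemxAl zK scaler0.
  move/xmax; rewrite -scalemxAl dotZl dotZr => h.
  rewrite dotZl dotZr in a1.
  have a2 : 0 < a ^+ 2 by rewrite exprn_even_gt0.
  rewrite -(ler_pM2l a2) expr2 -mulrA (le_trans h) // mulrCA -mulrA a1.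
  by rewrite mulr1.
exists x, lam; split => //.
have [r rE] : exists r, r = x *m A - lam *: x by exists (x *m A - lam *: x).
have rK : r *m K = 0.
  by rewrite rE mulmxBl AK // -scalemxAl xK scaler0 subrr.
have Axr : dot (r *m A) x = dot (x *m A) r by rewrite dot_mulmxl As dotC.
have rr : dot r r = dot (x *m A) r - lam * dot x r.
  by rewrite {1}rE dotDl dotNl dotZl.
(* Maximality of x against x + t r: the left-hand side is the value at x + t r
   of the quadratic form of A - lam, which vanishes at x. *)
have key t : t * 2 * dot r r + t ^+ 2 * (dot (r *m A) r - lam * dot r r) <= 0.
  have := mx (x + t *: r).
  rewrite mulmxDl xK -scalemxAl rK scaler0 addr0 => /(_ erefl).
  rewrite mulmxDl -scalemxAl !dotDl !dotDr !dotZl !dotZr -/lam x1 Axr rr.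
  rewrite (dotC r x) -subr_le0 => h; apply: le_trans h.
  by rewrite le_eqVlt; apply/orP; left; apply/eqP; ring.
set c := dot (r *m A) r - lam * dot r r in key.
apply/eqP; rewrite -subr_eq0 -rE -dot_eq0; apply/eqP.
have r0 := dot_ge0 r.
(* For this t the linear term outweighs the quadratic one, as c >= - |c|. *)
have := key (dot r r / (1 + `|c|)).
have c1 : 0 < 1 + `|c| by rewrite ltr_pwDl.
set q := dot r r in r0 *; set s := q / (1 + `|c|) => hs.
have qs : q = s * (1 + `|c|) by rewrite /s; field; rewrite gt_eqF.
have s0 : 0 <= s by rewrite /s divr_ge0 // ltW.
have cn : - `|c| <= c by rewrite lerNnormlW.
have cN : 0 <= `|c| by [].
move: hs; rewrite qs; move: (`|c|) cn cN => d cn cN hs.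
have [->|sn0] := eqVneq s 0; first by rewrite mul0r.
have sp : 0 < s by rewrite lt_def sn0.
exfalso; have : 0 < s ^+ 2 by rewrite exprn_gt0.
move: hs.
have -> : s * 2 * (s * (1 + d)) + s ^+ 2 * c = s ^+ 2 * (2 * (1 + d) + c) by ring.
rewrite pmulr_rle0 ?exprn_gt0 //; lra.
Qed.
(** The inductive step of the diagonalization.  Since A B = - B D, the matrix
    B B^T commutes with A, which gives a common eigenvector u.  If u B <> 0, its
    direction v works, with d = - a.  If u B = 0, then B is singular, so B^T has
    a nonzero kernel; D preserves it and has an eigenvector v there. *)
Lemma commuting_pair_eigenvector (R : realType) (n : nat)
    (A B D : 'M[R]_n.+1) :
  A^T = A -> D^T = D -> A *m B = - (B *m D) ->
  exists (u v : 'rV[R]_n.+1) (a b d : R),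
    [/\ dot u u = 1, dot v v = 1, u *m A = a *: u & v *m D = d *: v] /\
    (u *m B = b *: v /\ v *m B^T = b *: u).
Proof.
move=> As Ds AB.
have BA : B^T *m A = - (D *m B^T).
  by rewrite -{1}As -trmx_mul AB linearN /= trmx_mul Ds.
have [C CE] : exists C, C = B *m B^T by exists (B *m B^T).
have Cs : C^T = C by rewrite CE trmx_mul trmxK.
have AC : A *m C = C *m A.
  by rewrite CE mulmxA AB mulNmx -(mulmxA B) BA mulmxN mulmxA.
have [x [c [_ x1 xC]]] : exists (x : 'rV_n.+1) (c : R),
    [/\ x *m (0 : 'M[R]_(n.+1, 1)) = 0, dot x x = 1 & x *m C = c *: x].
  apply: kernel_eigenvector => //; first by move=> x; rewrite !mulmx0.
  exists (delta_mx 0 0); last by rewrite mulmx0.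
  by apply/eqP => /matrixP/(_ 0 0); rewrite !mxE => /eqP; rewrite oner_eq0.
have xn0 : x != 0 by rewrite -dot_eq0 x1 oner_eq0.
have [u [a [uC u1 uA]]] : exists (u : 'rV_n.+1) (a : R),
    [/\ u *m (C - c%:M) = 0, dot u u = 1 & u *m A = a *: u].
  apply: kernel_eigenvector => //.
    move=> y; rewrite !mulmxBr !mul_mx_scalar => /eqP.
    rewrite subr_eq0 => /eqP yC.
    by rewrite -mulmxA AC mulmxA yC -scalemxAl subrr.
  by exists x; rewrite // mulmxBr xC mul_mx_scalar subrr.
have {}uC : u *m C = c *: u.
  by apply/eqP; rewrite -subr_eq0 -mul_mx_scalar -mulmxBr uC.
have un0 : u != 0 by rewrite -dot_eq0 u1 oner_eq0.
have [uB|uB] := eqVneq (u *m B) 0.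
  have [v [d [vB v1 vD]]] : exists (v : 'rV_n.+1) (d : R),
      [/\ v *m B^T = 0, dot v v = 1 & v *m D = d *: v].
    apply: kernel_eigenvector => //.
      move=> y yB; rewrite -mulmxA -[D *m _]opprK -BA mulmxN mulmxA yB.
      by rewrite mul0mx oppr0.
    by apply/det0P; rewrite det_tr; apply/det0P; exists u.
  by exists u, v, a, 0, d; rewrite uB vB !scale0r.
have [s [s0 s1]] := unit_scalar uB.
have sc : s * c = s^-1.
  apply: (mulfI s0); rewrite mulfV // -[RHS]s1 dotZl dotZr; congr (_ * (_ * _)).
  by rewrite dot_mulmxl -mulmxA -CE uC dotZr u1 mulr1.
exists u, (s *: (u *m B)), a, s^-1, (- a); split; split => //.
- by rewrite -scalemxAl -mulmxA -[B *m D]opprK -AB mulmxN mulmxA uA -scalemxAl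
    -scaleNr scalerA mulrC -scalerA.
- by rewrite scalerA mulVf // scale1r.
- by rewrite -scalemxAl -mulmxA -CE uC scalerA sc.
Qed.

(** The reflection exchanging [u] with the first basis vector. *)
Lemma orthogonal_with_row0 (R : realType) (n : nat) (u : 'rV[R]_n.+1) :
  dot u u = 1 -> exists2 P : 'M[R]_n.+1, P *m P^T = 1%:M & row 0 P = u.
Proof.
move=> u1; pose e : 'rV[R]_n.+1 := delta_mx 0 0.
have [ue|] := eqVneq u e.
  by exists 1%:M; rewrite ?trmx1 ?mulmx1 // row1 ue.
rewrite -subr_eq0; have [w wE] : exists w, w = u - e by exists (u - e).
rewrite -wE -dot_eq0; set q := dot w w => q0.
have eu : dot e u = u 0 0.
  rewrite dotE (bigD1 0) //= mxE !eqxx mul1r big1 ?addr0 // => i i0.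
  by rewrite mxE (negbTE i0) andbF mul0r.
have e1 : dot e e = 1.
  rewrite dotE (bigD1 0) //= mxE !eqxx mul1r big1 ?addr0 // => i i0.
  by rewrite mxE (negbTE i0) andbF mul0r.
have qE : q = 2 - 2 * u 0 0.
  by rewrite /q wE !(dotDl, dotDr, dotNl, dotNr) u1 e1 (dotC u) eu; ring.
have ww : w *m w^T = q%:M by rewrite [LHS]mx11_scalar.
have [H HE] : exists H, H = w^T *m w by exists (w^T *m w).
have HT : H^T = H by rewrite HE trmx_mul trmxK.
have HH : H *m H = q *: H.
  by rewrite HE mulmxA -(mulmxA _ w) ww mul_mx_scalar -scalemxAl.
exists (1%:M - (2 / q) *: H).
  rewrite raddfB /= trmx1 [((2 / q) *: H)^T]linearZ /= HT.
  rewrite mulmxBl mul1mx mulmxBr mulmx1.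
  rewrite -scalemxAl -scalemxAr HH !scalerA.
  have -> : 2 / q * (2 / q) * q = 2 / q + 2 / q by field.
  rewrite scalerDl; move: (_ *: H) => X.
  by rewrite (_ : X - (X + X) = - X) ?opprK ?subrK // opprD addrA subrr add0r.
have w0 : w 0 0 = u 0 0 - 1 by rewrite wE !mxE.
apply/rowP => j; rewrite HE !mxE big_ord1 !mxE w0.
have -> : u 0 j = w 0 j + e 0 j by rewrite wE !mxE subrK.
rewrite [e 0 j]mxE eqxx /= addrC; congr (_ + _); last by rewrite eq_sym.
rewrite qE in q0 *; field.
exact: q0.
Qed.

(** The block sum of a scalar and a matrix, with its size written as a
    successor so that it can be used in an induction on the size. *)
Definition corner (R : pzRingType) (n : nat) (a : R) (M : 'M[R]_n) :
    'M[R]_n.+1 :=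
  block_mx (a%:M : 'M[R]_1) 0 0 M.

Lemma corner_mul (R : pzRingType) (n : nat) (a b : R) (M N : 'M[R]_n) :
  corner a M *m corner b N = corner (a * b) (M *m N).
Proof.
by rewrite /corner (@mulmx_block _ 1 n 1 n 1 n) !mul0mx !mulmx0 !add0r addr0
  -scalar_mxM.
Qed.

Lemma corner_tr (R : pzRingType) (n : nat) (a : R) (M : 'M[R]_n) :
  (corner a M)^T = corner a M^T.
Proof. by rewrite /corner (@tr_block_mx _ 1 n 1 n) tr_scalar_mx !trmx0. Qed.

Lemma corner_opp (R : pzRingType) (n : nat) (a : R) (M : 'M[R]_n) :
  - corner a M = corner (- a) (- M).
Proof. by rewrite /corner (@opp_block_mx _ 1 n 1 n) !oppr0 raddfN. Qed.

Lemma corner_inj (R : pzRingType) (n : nat) (a b : R) (M N : 'M[R]_n) :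
  corner a M = corner b N -> M = N.
Proof. by case/(@eq_block_mx _ 1 n 1 n). Qed.

Lemma corner1 (R : pzRingType) (n : nat) :
  corner 1 (1%:M : 'M[R]_n) = 1%:M.
Proof. by rewrite [RHS](@scalar_mx_block _ 1 n). Qed.

Lemma corner_diag (R : pzRingType) (n : nat) (a : R) (M : 'M[R]_n) :
  is_diag_mx M -> is_diag_mx (corner a M).
Proof.
by move=> Md; rewrite (@is_diag_block_mx _ 1 n 1 n) // mx11_is_diag !eqxx.
Qed.

Lemma corner_row0_col0 (R : pzRingType) (n : nat) (M : 'M[R]_n.+1) (a : R) :
  row 0 M = a *: delta_mx 0 0 -> row 0 M^T = a *: delta_mx 0 0 ->
  exists N, M = corner a N.
Proof.
have l0 : @lshift 1 n 0 = (0 : 'I_n.+1) by apply/val_inj.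
move=> /rowP r /rowP c; exists (drsubmx (M : 'M[R]_(1 + n))).
have {}r k : M 0 k = a * (k == 0)%:R by have := r k; rewrite !mxE.
have {}c k : M k 0 = a * (k == 0)%:R by have := c k; rewrite !mxE.
apply: etrans (esym (@submxK _ 1 n 1 n M)) _.
congr (@block_mx _ 1 n 1 n _ _ _ _); apply/matrixP => i j.
- by rewrite [i]ord1 [j]ord1 !mxE !l0 r eqxx mulr1.
- by rewrite [i]ord1 !mxE !l0 r mulr0.
- by rewrite [j]ord1 !mxE !l0 c mulr0.
Qed.

(** The singular value decomposition of B, adapted to A and D: rows of P and Q
    are produced in pairs by [commuting_pair_eigenvector], and the relation
    A B = - B D survives on the orthogonal complements. *)
Lemma simultaneous_diagonalization (R : realType) (n : nat)
    (A B D : 'M[R]_n) :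
  A^T = A -> D^T = D -> A *m B = - (B *m D) ->
  exists P Q : 'M[R]_n, [/\ P *m P^T = 1%:M, Q *m Q^T = 1%:M,
    is_diag_mx (P *m A *m P^T), is_diag_mx (P *m B *m Q^T) &
    is_diag_mx (Q *m D *m Q^T)].
Proof.
elim: n A B D => [|n IH] A B D As Ds AB.
  exists 1%:M, 1%:M; split; try by apply/matrixP; case.
  - by apply/is_diag_mxP; case.
  - by apply/is_diag_mxP; case.
  - by apply/is_diag_mxP; case.
have [u [v [a [b [d [[u1 v1 uA vD] [uB vB]]]]]]] :=
  commuting_pair_eigenvector As Ds AB.
have [U UU Uu] := orthogonal_with_row0 u1.
have [V VV Vv] := orthogonal_with_row0 v1.
have UtU : U^T *m U = 1%:M by apply: mulmx1C.
have VtV : V^T *m V = 1%:M by apply: mulmx1C.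
have uU : u *m U^T = delta_mx 0 0 by rewrite -Uu -row_mul UU row1.
have vV : v *m V^T = delta_mx 0 0 by rewrite -Vv -row_mul VV row1.
have [A1 A1E] : exists A1, U *m A *m U^T = corner a A1.
  apply: corner_row0_col0; first by rewrite !row_mul Uu uA -scalemxAl uU.
  by rewrite !trmx_mul trmxK As mulmxA !row_mul Uu uA -scalemxAl uU.
have [D1 D1E] : exists D1, V *m D *m V^T = corner d D1.
  apply: corner_row0_col0; first by rewrite !row_mul Vv vD -scalemxAl vV.
  by rewrite !trmx_mul trmxK Ds mulmxA !row_mul Vv vD -scalemxAl vV.
have [B1 B1E] : exists B1, U *m B *m V^T = corner b B1.
  apply: corner_row0_col0; first by rewrite !row_mul Uu uB -scalemxAl vV.
  by rewrite !trmx_mul trmxK mulmxA !row_mul Vv vB -scalemxAl uU.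
have A1s : A1^T = A1.
  apply: (@corner_inj _ _ a a); rewrite -corner_tr -A1E.
  by rewrite !trmx_mul trmxK As mulmxA.
have D1s : D1^T = D1.
  apply: (@corner_inj _ _ d d); rewrite -corner_tr -D1E.
  by rewrite !trmx_mul trmxK Ds mulmxA.
have AB1 : A1 *m B1 = - (B1 *m D1).
  apply: (@corner_inj _ _ (a * b) (- (b * d))).
  rewrite -corner_opp -!corner_mul -A1E -B1E -D1E.
  by rewrite !mulmxA -(mulmxA _ U^T U) -(mulmxA _ V^T V) UtU VtV !mulmx1
    -(mulmxA U A B) AB mulmxN mulNmx !mulmxA.
have [P [Q [PP QQ PA PB QD]]] := IH _ _ _ A1s D1s AB1.
have conj (S T : 'M[R]_n) (X Y Z : 'M[R]_n.+1) :
    corner 1 S *m X *m Z *m (corner 1 T *m Y)^T =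
    corner 1 S *m (X *m Z *m Y^T) *m corner 1 T^T.
  by rewrite trmx_mul corner_tr !mulmxA.
exists (corner 1 P *m U), (corner 1 Q *m V); split.
- have := conj P P U U 1%:M; rewrite !mulmx1 => ->.
  by rewrite UU mulmx1 corner_mul PP mul1r corner1.
- have := conj Q Q V V 1%:M; rewrite !mulmx1 => ->.
  by rewrite VV mulmx1 corner_mul QQ mul1r corner1.
- by rewrite conj A1E !corner_mul corner_diag.
- by rewrite conj B1E !corner_mul corner_diag.
- by rewrite conj D1E !corner_mul corner_diag.
Qed.

(** * Curvature-like tensors and change of basis *)

Definition curvature_like (R : pzRingType) (n : nat)
    (K : 'I_n -> 'I_n -> 'I_n -> 'I_n -> R) : Prop :=
  [/\ forall i j k l, K j i k l = - K i j k l,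
      forall i j k l, K i j l k = - K i j k l &
      forall i j k l, K k l i j = K i j k l].

(** The tensor as a bilinear form on matrices; on antisymmetric matrices it is
    four times the curvature form on bivectors. *)
Definition biform (R : pzRingType) (n : nat)
    (K : 'I_n -> 'I_n -> 'I_n -> 'I_n -> R) (X Y : 'M[R]_n) : R :=
  \sum_a \sum_b X a b * (\sum_c \sum_d Y c d * K a b c d).

(** The components of the tensor in the frame whose vectors are the rows of
    [E].  Writing them with [biform] reduces changes of basis to conjugation of
    the matrix arguments. *)
Definition pull (R : pzRingType) (m n : nat) (E : 'M[R]_(m, n))
    (K : 'I_n -> 'I_n -> 'I_n -> 'I_n -> R) :
    'I_m -> 'I_m -> 'I_m -> 'I_m -> R :=
  fun i j k l =>
    biform K (E^T *m delta_mx i j *m E) (E^T *m delta_mx k l *m E).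

Lemma biform_linearl (R : comPzRingType) (n : nat)
    (K : 'I_n -> 'I_n -> 'I_n -> 'I_n -> R) (Y : 'M[R]_n) (a : R)
    (X1 X2 : 'M[R]_n) :
  biform K (a *: X1 + X2) Y = a * biform K X1 Y + biform K X2 Y.
Proof.
rewrite /biform big_distrr -big_split; apply: eq_bigr => i _ /=.
rewrite big_distrr -big_split; apply: eq_bigr => j _ /=.
by rewrite !mxE mulrDl mulrA.
Qed.

Lemma biform_linearr (R : comPzRingType) (n : nat)
    (K : 'I_n -> 'I_n -> 'I_n -> 'I_n -> R) (X : 'M[R]_n) (a : R)
    (Y1 Y2 : 'M[R]_n) :
  biform K X (a *: Y1 + Y2) = a * biform K X Y1 + biform K X Y2.
Proof.
rewrite /biform big_distrr -big_split; apply: eq_bigr => i _ /=.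
rewrite big_distrr -big_split; apply: eq_bigr => j _ /=.
rewrite mulrCA -mulrDr; congr (_ * _).
rewrite big_distrr -big_split; apply: eq_bigr => k _ /=.
rewrite big_distrr -big_split; apply: eq_bigr => l _ /=.
by rewrite !mxE mulrDl mulrA.
Qed.

Lemma biform0l (R : comPzRingType) (n : nat)
    (K : 'I_n -> 'I_n -> 'I_n -> 'I_n -> R) (Y : 'M[R]_n) : biform K 0 Y = 0.
Proof.
by rewrite /biform big1 // => i _; rewrite big1 // => j _; rewrite mxE mul0r.
Qed.

Lemma biform0r (R : comPzRingType) (n : nat)
    (K : 'I_n -> 'I_n -> 'I_n -> 'I_n -> R) (X : 'M[R]_n) : biform K X 0 = 0.
Proof.
rewrite /biform big1 // => i _; rewrite big1 // => j _.
by rewrite big1 ?mulr0 // => k _; rewrite big1 // => l _; rewrite mxE mul0r.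
Qed.

Lemma biform_suml (R : comPzRingType) (n : nat)
    (K : 'I_n -> 'I_n -> 'I_n -> 'I_n -> R) (I : finType) (c : I -> R)
    (X : I -> 'M[R]_n) (Y : 'M[R]_n) :
  biform K (\sum_i c i *: X i) Y = \sum_i c i * biform K (X i) Y.
Proof.
apply: (big_rec2 (fun x y => biform K x Y = y)); first exact: biform0l.
by move=> i y x _ <-; rewrite biform_linearl.
Qed.

Lemma biform_sumr (R : comPzRingType) (n : nat)
    (K : 'I_n -> 'I_n -> 'I_n -> 'I_n -> R) (I : finType) (c : I -> R)
    (X : 'M[R]_n) (Y : I -> 'M[R]_n) :
  biform K X (\sum_i c i *: Y i) = \sum_i c i * biform K X (Y i).
Proof.
apply: (big_rec2 (fun x y => biform K X x = y)); first exact: biform0r.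
by move=> i y x _ <-; rewrite biform_linearr.
Qed.

Lemma conjmx_sum_delta (R : comPzRingType) (m n : nat) (E : 'M[R]_(m, n))
    (X : 'M[R]_m) :
  E^T *m X *m E =
  \sum_(p : 'I_m * 'I_m) X p.1 p.2 *: (E^T *m delta_mx p.1 p.2 *m E).
Proof.
rewrite {1}[X]matrix_sum_delta pair_bigA /= mulmx_sumr mulmx_suml.
by apply: eq_bigr => p _; rewrite -scalemxAr -scalemxAl.
Qed.

Lemma biform_pull (R : comPzRingType) (m n : nat) (E : 'M[R]_(m, n))
    (K : 'I_n -> 'I_n -> 'I_n -> 'I_n -> R) (X Y : 'M[R]_m) :
  biform (pull E K) X Y = biform K (E^T *m X *m E) (E^T *m Y *m E).
Proof.
rewrite (conjmx_sum_delta E X) biform_suml [LHS]pair_bigA /=.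
apply: eq_bigr => -[i j] _; congr (_ * _).
by rewrite (conjmx_sum_delta E Y) biform_sumr [LHS]pair_bigA.
Qed.

Lemma pull_mul (R : comPzRingType) (l m n : nat) (E : 'M[R]_(l, m))
    (F : 'M[R]_(m, n)) (K : 'I_n -> 'I_n -> 'I_n -> 'I_n -> R) :
  pull E (pull F K) = pull (E *m F) K.
Proof.
apply/funext => i; apply/funext => j; apply/funext => k; apply/funext => h.
by rewrite {1}/pull biform_pull /pull trmx_mul !mulmxA.
Qed.

Lemma biform_tr (R : comPzRingType) (n : nat)
    (K : 'I_n -> 'I_n -> 'I_n -> 'I_n -> R) (X Y : 'M[R]_n) :
  curvature_like K ->
  [/\ biform K X^T Y = - biform K X Y, biform K X Y^T = - biform K X Y &
      biform K Y X = biform K X Y].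
Proof.
case=> K1 K2 K3; split.
- rewrite /biform exchange_big -sumrN; apply: eq_bigr => i _ /=.
  rewrite -sumrN; apply: eq_bigr => j _ /=; rewrite mxE -mulrN; congr (_ * _).
  rewrite -sumrN; apply: eq_bigr => k _ /=.
  by rewrite -sumrN; apply: eq_bigr => l _ /=; rewrite K1 mulrN.
- rewrite /biform -sumrN; apply: eq_bigr => i _ /=.
  rewrite -sumrN; apply: eq_bigr => j _ /=; rewrite -mulrN; congr (_ * _).
  rewrite exchange_big -sumrN; apply: eq_bigr => k _ /=.
  by rewrite -sumrN; apply: eq_bigr => l _ /=; rewrite K2 mxE mulrN.
- rewrite /biform [LHS]pair_bigA [RHS]pair_bigA /=.
  under eq_bigr do rewrite pair_bigA big_distrr /=.
  under [RHS]eq_bigr do rewrite pair_bigA big_distrr /=.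
  rewrite exchange_big; apply: eq_bigr => p _; apply: eq_bigr => q _ /=.
  by rewrite K3 mulrCA.
Qed.

Lemma curvature_like_pull (R : comPzRingType) (m n : nat) (E : 'M[R]_(m, n))
    (K : 'I_n -> 'I_n -> 'I_n -> 'I_n -> R) :
  curvature_like K -> curvature_like (pull E K).
Proof.
move=> Kc.
have tE i j : E^T *m delta_mx j i *m E = (E^T *m delta_mx i j *m E)^T.
  by rewrite !trmx_mul trmxK trmx_delta mulmxA.
split=> i j k l; rewrite /pull;
  have [f1 f2 f3] := biform_tr (E^T *m delta_mx i j *m E)
    (E^T *m delta_mx k l *m E) Kc.
- by rewrite tE.
- by rewrite (tE k l).
- exact: f3.
Qed.

(** * Self-dual and anti-self-dual bivectors *)

Local Notation o k := (@Ordinal 4 k isT) (only parsing).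
Local Notation p k := (@Ordinal 3 k isT) (only parsing).

Lemma ord3E (P : 'I_3 -> Prop) : P (p 0) -> P (p 1) -> P (p 2) -> forall i, P i.
Proof.
by move=> P0 P1 P2 [[|[|[|i]]] //= hi]; rewrite (bool_irrelevance hi isT).
Qed.

Lemma ord4E (P : 'I_4 -> Prop) :
  P (o 0) -> P (o 1) -> P (o 2) -> P (o 3) -> forall i, P i.
Proof.
by move=> P0 P1 P2 P3 [[|[|[|[|i]]]] //= hi]; rewrite (bool_irrelevance hi isT).
Qed.

Lemma sum3 (V : nmodType) (F : 'I_3 -> V) :
  \sum_i F i = F (p 0) + F (p 1) + F (p 2).
Proof.
rewrite !big_ord_recl big_ord0 addr0 !addrA.
by congr (F _ + F _ + F _); apply/val_inj.
Qed.

Lemma sum4 (V : nmodType) (F : 'I_4 -> V) :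
  \sum_i F i = F (o 0) + F (o 1) + F (o 2) + F (o 3).
Proof.
rewrite !big_ord_recl big_ord0 addr0 !addrA.
by congr (F _ + F _ + F _ + F _); apply/val_inj.
Qed.

(** For s = 1 (resp. s = - 1) these are the self-dual (resp. anti-self-dual)
    bivectors; they are also the matrices of quaternion multiplication on one
    side (resp. the other) by imaginary quaternions. *)
Definition sdform (R : pzRingType) (s : R) (u : 'rV[R]_3) : 'M[R]_4 :=
  let x := u 0 (p 0) in let y := u 0 (p 1) in let z := u 0 (p 2) in
  \matrix_(a, b) nth 0 (nth [::]
    [:: [:: 0; x; y; z];
        [:: - x; 0; s * z; - (s * y)];
        [:: - y; - (s * z); 0; s * x];
        [:: - z; s * y; - (s * x); 0]] a) b.

Definition cross (R : pzRingType) (u v : 'rV[R]_3) : 'rV[R]_3 :=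
  \row_i nth 0
    [:: u 0 (p 1) * v 0 (p 2) - u 0 (p 2) * v 0 (p 1);
        u 0 (p 2) * v 0 (p 0) - u 0 (p 0) * v 0 (p 2);
        u 0 (p 0) * v 0 (p 1) - u 0 (p 1) * v 0 (p 0)] i.

Lemma sdform_tr (R : comPzRingType) (s : R) (u : 'rV[R]_3) :
  (sdform s u)^T = - sdform s u.
Proof.
by apply/matrixP; do 2!elim/ord4E; rewrite !mxE /= ?opprK ?oppr0.
Qed.

Lemma sdform_mul (R : comRingType) (s : R) (u v : 'rV[R]_3) : s * s = 1 ->
  sdform s u *m sdform s v = - ((dot u v)%:M + s *: sdform s (cross u v)).
Proof.
move=> ss; apply/matrixP; do 2!elim/ord4E;
  rewrite !mxE sum4 dotE sum3 !mxE /=.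
all: ring: ss.
Qed.

(** Left and right quaternion multiplications commute. *)
Lemma sdform_comm (R : comRingType) (u v : 'rV[R]_3) :
  sdform 1 u *m sdform (- 1) v = sdform (- 1) v *m sdform 1 u.
Proof.
apply/matrixP; do 2!elim/ord4E; rewrite !mxE !sum4 !mxE /=; ring.
Qed.

Lemma sdform_mul_trace0 (R : comRingType) (u v : 'rV[R]_3) :
  \tr (sdform 1 u *m sdform (- 1) v) = 0.
Proof. rewrite /mxtrace sum4 !mxE !sum4 !mxE /=; ring. Qed.

Lemma dot_sdform0 (R : comRingType) (s : R) (u : 'rV[R]_3) (e : 'rV[R]_4) :
  dot e (e *m sdform s u) = 0.
Proof. rewrite dotE !sum4 !mxE !sum4 !mxE /=; ring. Qed.

(** A bivector of either type is a multiple of a complex structure, and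
    orthogonal bivectors map a vector to orthogonal vectors. *)
Lemma dot_sdform (R : comRingType) (s : R) (u v : 'rV[R]_3) (e : 'rV[R]_4) :
  s * s = 1 ->
  dot (e *m sdform s u) (e *m sdform s v) = dot u v * dot e e.
Proof.
move=> ss; rewrite dot_mulmxl sdform_tr mulmxN -mulmxA sdform_mul //.
rewrite mulmxN opprK mulmxDr mul_mx_scalar -scalemxAr dotDr !dotZr.
by rewrite dot_sdform0 mulr0 addr0 dotC.
Qed.

Lemma det_mx2 (R : comRingType) (A : 'M[R]_2) :
  \det A = A 0 0 * A 1 1 - A 0 1 * A 1 0.
Proof.
rewrite (expand_det_row A 0) !big_ord_recl big_ord0 addr0 /cofactor !det_mx11.
rewrite !mxE /= expr0 mul1r expr1 mulN1r mulrN.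
by congr (A _ _ * A _ _ - A _ _ * A _ _); apply/val_inj.
Qed.

Lemma lift3E :
  (lift (p 0) (0 : 'I_2) = p 1) * (lift (p 0) (1 : 'I_2) = p 2) *
  (lift (p 1) (0 : 'I_2) = p 0) * (lift (p 1) (1 : 'I_2) = p 2) *
  (lift (p 2) (0 : 'I_2) = p 0) * (lift (p 2) (1 : 'I_2) = p 1).
Proof. by do !split; apply/val_inj. Qed.

(** A rotation equals its own cofactor matrix. *)
Lemma cross_row (R : comRingType) (P : 'M[R]_3) :
  P *m P^T = 1%:M -> \det P = 1 ->
  [/\ cross (row (p 0) P) (row (p 1) P) = row (p 2) P,
      cross (row (p 1) P) (row (p 2) P) = row (p 0) P &
      cross (row (p 2) P) (row (p 0) P) = row (p 1) P].
Proof.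
move=> PP dP; have adjP : \adj P = P^T.
  by rewrite -[LHS]mulmx1 -PP mulmxA mul_adj_mx dP mul1mx.
have PE i j : P i j = cofactor P i j.
  by have /matrixP/(_ j i) := adjP; rewrite !mxE.
by split; apply/rowP; elim/ord3E;
  rewrite !mxE /= [RHS]PE /cofactor det_mx2 !mxE /=
  !lift3E; ring.
Qed.

(** The product (1 - Z1)(1 - Z0) has trace n + 1, hence is not zero, and its
    rows are common eigenvectors for the eigenvalue - 1. *)
Lemma commuting_involutions_eigenvector (R : realType) (n : nat)
    (Z0 Z1 : 'M[R]_n.+1) :
  Z0 *m Z0 = 1%:M -> Z1 *m Z1 = 1%:M -> Z0 *m Z1 = Z1 *m Z0 ->
  \tr Z0 = 0 -> \tr Z1 = 0 -> \tr (Z0 *m Z1) = 0 ->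
  exists e : 'rV[R]_n.+1, [/\ dot e e = 1, e *m Z0 = - e & e *m Z1 = - e].
Proof.
move=> Z00 Z11 Z01 t0 t1 t01.
have [T TE] : exists T, T = (1%:M - Z1) *m (1%:M - Z0).
  by exists ((1%:M - Z1) *m (1%:M - Z0)).
have anti (Z : 'M[R]_n.+1) : Z *m Z = 1%:M -> (1%:M - Z) *m Z = - (1%:M - Z).
  by move=> ZZ; rewrite mulmxBl ZZ mul1mx opprB.
have T0 : T *m Z0 = - T by rewrite TE -(mulmxA (1%:M - Z1)) anti // mulmxN.
have T1 : T *m Z1 = - T.
  have -> : T = (1%:M - Z0) *m (1%:M - Z1).
    rewrite TE !mulmxBl !mul1mx !mulmxBr !mulmx1 Z01; move: (Z1 *m Z0) => Z.
    by apply/matrixP => i j; rewrite !mxE; ring.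
  by rewrite -(mulmxA (1%:M - Z0)) anti // mulmxN.
have T_neq0 : T != 0.
  apply/eqP => T_eq0; have : \tr T = n.+1%:R.
    rewrite TE mulmxBl mul1mx mulmxBr mulmx1 -Z01 !raddfB /= t0 t1 t01.
    by rewrite !(oppr0, addr0) mxtrace1.
  by rewrite T_eq0 mxtrace0 => /esym/eqP; rewrite pnatr_eq0.
have [i Ti] : exists i, row i T != 0.
  apply/existsP; apply: contraNT T_neq0; rewrite negb_exists => /forallP h.
  apply/eqP/row_matrixP => i; rewrite row0; apply/eqP.
  by have := h i; rewrite negbK.
have [a [_ a1]] := unit_scalar Ti.
exists (a *: row i T); split => //.
  by rewrite -scalemxAl -row_mul T0 linearN /= scalerN.
by rewrite -scalemxAl -row_mul T1 linearN /= scalerN.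
Qed.

Lemma sdformN (R : comPzRingType) (s : R) (u : 'rV[R]_3) :
  sdform s (- u) = - sdform s u.
Proof.
by apply/matrixP; do 2!elim/ord4E; rewrite !mxE /= ?oppr0 ?mulrN.
Qed.

Lemma crossC (R : comRingType) (u v : 'rV[R]_3) : cross v u = - cross u v.
Proof. by apply/rowP; elim/ord3E; rewrite !mxE /=; ring. Qed.

Lemma crossvv (R : comRingType) (u : 'rV[R]_3) : cross u u = 0.
Proof. by apply/rowP; elim/ord3E; rewrite !mxE /=; ring. Qed.

Lemma sdform0 (R : comPzRingType) (s : R) : sdform s 0 = 0.
Proof.
by apply/matrixP; do 2!elim/ord4E; rewrite !mxE /= ?mulr0 ?oppr0.
Qed.

Lemma mulmx_tr_dot (R : comPzRingType) (m n : nat) (A B : 'M[R]_(m, n)) i j :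
  (A *m B^T) i j = dot (row i A) (row j B).
Proof. by rewrite dotE !mxE; apply: eq_bigr => k _; rewrite !mxE. Qed.

(** The image of the vector [e] under 1 and the three complex structures given
    by the rows of [P]: the first standard basis vector is sent by the bivectors
    of the standard basis to the three others, for both values of [s]. *)
Definition frame (R : pzRingType) (s : R) (P : 'M[R]_3) (e : 'rV[R]_4) :
    'M[R]_4 :=
  \matrix_(a < 4) nth 0 [:: e; e *m sdform s (row (p 0) P);
    e *m sdform s (row (p 1) P); e *m sdform s (row (p 2) P)] a.

Lemma sdform_rows_mul (R : comRingType) (s : R) (P : 'M[R]_3) (i j : 'I_3) :
  s * s = 1 -> P *m P^T = 1%:M ->
  sdform s (row i P) *m sdform s (row j P) =
  - ((i == j)%:R%:M + s *: sdform s (cross (row i P) (row j P))).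
Proof.
by move=> ss PP; rewrite sdform_mul // -mulmx_tr_dot PP mxE.
Qed.

(** The quaternion relations among the rows of [P] say that, in the frame
    [frame s P e], the rows of [P] are the standard bivectors. *)
Lemma frame_sdform (R : comRingType) (s : R) (P : 'M[R]_3) (e : 'rV[R]_4)
    (i : 'I_3) :
  s * s = 1 -> P *m P^T = 1%:M -> \det P = 1 ->
  frame s P e *m sdform s (row i P) = sdform s (delta_mx 0 i) *m frame s P e.
Proof.
move=> ss PP dP; have [c01 c12 c20] := cross_row PP dP.
have c10 := crossC (row (p 0) P) (row (p 1) P); rewrite c01 in c10.
have c21 := crossC (row (p 1) P) (row (p 2) P); rewrite c12 in c21.
have c02 := crossC (row (p 2) P) (row (p 0) P); rewrite c20 in c02.
apply/row_matrixP; elim/ord4E;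
  rewrite !row_mul [RHS]mulmx_sum_row sum4 /frame !rowK /=;
  elim/ord3E: i => /=; rewrite !mxE /= -?mulmxA ?sdform_rows_mul //
    ?(c01, c12, c20, c10, c21, c02) ?crossvv ?sdformN ?sdform0 ?eqxx /=.
all: rewrite ?mulmxN ?mulmxDr -?scalemxAr ?mulmxN ?mulmx0 ?mul_mx_scalar.
all: move: (e *m sdform s (row (p 0) P)) (e *m sdform s (row (p 1) P))
  (e *m sdform s (row (p 2) P)) => x y z.
all: by apply/rowP => k; rewrite !mxE; ring: ss.
Qed.

Lemma frame_orthogonal (R : comRingType) (s : R) (P : 'M[R]_3) (e : 'rV[R]_4) :
  s * s = 1 -> P *m P^T = 1%:M -> dot e e = 1 ->
  frame s P e *m (frame s P e)^T = 1%:M.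
Proof.
move=> ss PP ee; apply/matrixP; do 2!elim/ord4E;
  rewrite mulmx_tr_dot /frame !rowK /= mxE /=.
all: by rewrite ?(dotC (e *m _) e) ?dot_sdform0 ?dot_sdform // ?ee // ?mulr1
  -?mulmx_tr_dot ?PP ?mxE.
Qed.

(** Surjectivity of SO(4) -> SO(3) x SO(3).  With X_i and Y_i the complex
    structures given by the rows of P and Q, the operators X_i Y_i are commuting
    involutions of trace zero.  A common eigenvector e for the eigenvalue - 1
    satisfies e X_i = e Y_i for all i, so the frames built from e with P and
    with Q coincide. *)
Lemma so3_pair_lift (R : realType) (P Q : 'M[R]_3) :
  P *m P^T = 1%:M -> \det P = 1 -> Q *m Q^T = 1%:M -> \det Q = 1 ->
  exists E : 'M[R]_4, [/\ E *m E^T = 1%:M,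
    forall i, E^T *m sdform 1 (delta_mx 0 i) *m E = sdform 1 (row i P) &
    forall i, E^T *m sdform (- 1) (delta_mx 0 i) *m E = sdform (- 1) (row i Q)].
Proof.
move=> PP dP QQ dQ.
have s1 : 1 * 1 = 1 :> R by rewrite mulr1.
have sN1 : (- 1) * (- 1) = 1 :> R by rewrite mulrNN mulr1.
have [c01 _ _] := cross_row PP dP; have [d01 _ _] := cross_row QQ dQ.
have c10 := crossC (row (p 0) P) (row (p 1) P); rewrite c01 in c10.
pose X i := sdform 1 (row i P); pose Y i := sdform (- 1) (row i Q).
have XY i j : X i *m Y j = Y j *m X i by exact: sdform_comm.
have XX i : X i *m X i = - 1%:M.
  by rewrite sdform_rows_mul // crossvv sdform0 scaler0 addr0 eqxx.
have YY i : Y i *m Y i = - 1%:M.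
  by rewrite sdform_rows_mul // crossvv sdform0 scaler0 addr0 eqxx.
have X01 : X (p 0) *m X (p 1) = - X (p 2).
  by rewrite sdform_rows_mul // c01 scale1r -scalemx1 scale0r add0r.
have X10 : X (p 1) *m X (p 0) = X (p 2).
  rewrite sdform_rows_mul // c10 sdformN scale1r -scalemx1 scale0r.
  by rewrite add0r opprK.
have Y01 : Y (p 0) *m Y (p 1) = Y (p 2).
  by rewrite sdform_rows_mul // d01 scaleN1r -scalemx1 scale0r add0r opprK.
have Z i j : (X i *m Y i) *m (X j *m Y j) = (X i *m X j) *m (Y i *m Y j).
  by rewrite !mulmxA -(mulmxA (X i) (Y i)) -XY !mulmxA.
have Z1 i : (X i *m Y i) *m (X i *m Y i) = 1%:M.
  by rewrite Z XX YY mulmxN mulmx1 opprK.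
have Z01 :
  (X (p 0) *m Y (p 0)) *m (X (p 1) *m Y (p 1)) = - (X (p 2) *m Y (p 2)).
  by rewrite Z X01 Y01 mulNmx.
have Y10 : Y (p 1) *m Y (p 0) = - Y (p 2).
  have d10 := crossC (row (p 0) Q) (row (p 1) Q); rewrite d01 in d10.
  rewrite sdform_rows_mul // d10 sdformN scaleN1r -scalemx1 scale0r.
  by rewrite add0r opprK.
have [e [ee e0 e1]] : exists e : 'rV[R]_4, [/\ dot e e = 1,
    e *m (X (p 0) *m Y (p 0)) = - e & e *m (X (p 1) *m Y (p 1)) = - e].
  apply: commuting_involutions_eigenvector; rewrite ?sdform_mul_trace0 //.
    by rewrite Z01 Z X10 Y10 mulmxN.
  by rewrite Z01 raddfN /= sdform_mul_trace0 oppr0.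
have eXY i : e *m (X i *m Y i) = - e -> e *m X i = e *m Y i.
  move=> ei; apply: oppr_inj; rewrite -[RHS]mulNmx -ei -!mulmxA YY.
  by rewrite !mulmxN mulmx1.
have e2 : e *m X (p 2) = e *m Y (p 2).
  by rewrite -X10 mulmxA eXY // -mulmxA -XY mulmxA eXY // -mulmxA Y01.
have frameE : frame 1 P e = frame (- 1) Q e.
  by apply/row_matrixP; elim/ord4E; rewrite !rowK //=; [exact: eXY|exact: eXY].
have EE := frame_orthogonal s1 PP ee.
exists (frame 1 P e); split => // i.
  by rewrite -mulmxA -frame_sdform // mulmxA (mulmx1C EE) mul1mx.
rewrite frameE in EE *.
by rewrite -mulmxA -frame_sdform // mulmxA (mulmx1C EE) mul1mx.
Qed.

(** * The blocks of a curvature-like tensor *)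

(** The planes containing the first axis, and their orthogonal planes oriented
    so that the sum of corresponding bivectors is self-dual. *)
Definition plane (i : 'I_3) : 'I_4 * 'I_4 :=
  nth (o 0, o 0) [:: (o 0, o 1); (o 0, o 2); (o 0, o 3)] i.
Definition coplane (i : 'I_3) : 'I_4 * 'I_4 :=
  nth (o 0, o 0) [:: (o 2, o 3); (o 3, o 1); (o 1, o 2)] i.

(** The blocks A, B, B^T and D are [block 1 1], [block 1 (- 1)],
    [block (- 1) 1] and [block (- 1) (- 1)]. *)
Definition block (R : pzRingType) (s t : R)
    (K : 'I_4 -> 'I_4 -> 'I_4 -> 'I_4 -> R) : 'M[R]_3 :=
  let k (P Q : 'I_4 * 'I_4) := K P.1 P.2 Q.1 Q.2 in
  \matrix_(i, j)
    (k (plane i) (plane j) + s * k (coplane i) (plane j) +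
     t * k (plane i) (coplane j) + s * t * k (coplane i) (coplane j)).

(** [plane_sign] and [plane_index] express each pair of axes in the list of six
    oriented planes 01, 02, 03, 23, 31, 12. *)
Definition plane_sign (R : pzRingType) (a b : 'I_4) : R :=
  nth 0 (nth [::] [:: [:: 0; 1; 1; 1]; [:: -1; 0; 1; -1];
                      [:: -1; -1; 0; 1]; [:: -1; 1; -1; 0]] a) b.
Definition plane_index (a b : 'I_4) : nat :=
  nth 0%N (nth [::] [:: [:: 0; 0; 1; 2]; [:: 0; 0; 5; 4];
                        [:: 1; 5; 0; 3]; [:: 2; 4; 3; 0]]%N a) b.

Lemma antisym_planeE (R : numDomainType) (f : 'I_4 -> 'I_4 -> R) :
  (forall a b, f b a = - f a b) ->
  forall a b, f a b = plane_sign R a b *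
    nth 0 [:: f (o 0) (o 1); f (o 0) (o 2); f (o 0) (o 3);
              f (o 2) (o 3); f (o 3) (o 1); f (o 1) (o 2)] (plane_index a b).
Proof.
move=> fN; have f0 a : f a a = 0.
  by apply/eqP; have /eqP := fN a a; rewrite -addr_eq0 -mulr2n mulrn_eq0.
by do 2!elim/ord4E; rewrite /= ?mul0r ?mul1r ?mulN1r //; rewrite f0.
Qed.

(** A normal form in which the antisymmetries are built in, so that identities
    between components reduce to polynomial identities in the entries of a
    symmetric 6 x 6 array. *)
Lemma curvature_likeE (R : numDomainType)
    (K : 'I_4 -> 'I_4 -> 'I_4 -> 'I_4 -> R) :
  curvature_like K ->
  exists2 H : nat -> nat -> R, (forall x y, H x y = H y x) &
    K = fun a b c d => plane_sign R a b * plane_sign R c d *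
                       H (plane_index a b) (plane_index c d).
Proof.
case=> K1 K2 K3.
pose pl x := nth (o 0, o 0) [:: (o 0, o 1); (o 0, o 2); (o 0, o 3);
  (o 2, o 3); (o 3, o 1); (o 1, o 2)] x.
exists (fun x y => K (pl x).1 (pl x).2 (pl y).1 (pl y).2); first by move=> x y.
apply/funext => a; apply/funext => b; apply/funext => c; apply/funext => d.
have pE (f : 'I_4 -> 'I_4 -> R) a' b' : (forall a b, f b a = - f a b) ->
    f a' b' = plane_sign R a' b' *
      f (pl (plane_index a' b')).1 (pl (plane_index a' b')).2.
  by move=> fN; rewrite (antisym_planeE fN); congr (_ * _);
    move: a' b'; do 2!elim/ord4E.
rewrite (pE (fun a b => K a b c d)) // (pE (K _ _) c d) //.
by rewrite mulrA.
Qed.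

Lemma biform_sdform (R : numDomainType)
    (K : 'I_4 -> 'I_4 -> 'I_4 -> 'I_4 -> R) (s t : R) (u v : 'rV[R]_3) :
  curvature_like K ->
  biform K (sdform s u) (sdform t v) = 4 * dot (u *m block s t K) v.
Proof.
case/curvature_likeE => H Hs ->.
rewrite dotE /biform !sum4 !mxE /= !sum3 !mxE !sum3 !mxE /plane_sign /=; ring.
Qed.

Definition ricci2 (R : pzRingType) (n : nat)
    (K : 'I_n -> 'I_n -> 'I_n -> 'I_n -> R) (i j : 'I_n) : R :=
  \sum_a \sum_b \sum_c K a b c i * K a b c j.

(** The off-diagonal block A B + B D of the square of the curvature operator. *)
Definition offblock (R : pzRingType) (K : 'I_4 -> 'I_4 -> 'I_4 -> 'I_4 -> R) :
    'M[R]_3 :=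
  block 1 1 K *m block 1 (- 1) K + block 1 (- 1) K *m block (- 1) (- 1) K.

(** An entry of the square of the 6 x 6 curvature operator. *)
Definition plane_sqr (R : pzRingType) (H : nat -> nat -> R) (x y : nat) : R :=
  H 0 x * H 0 y + H 1 x * H 1 y + H 2 x * H 2 y +
  H 3 x * H 3 y + H 4 x * H 4 y + H 5 x * H 5 y.

(** Each plane is met twice, with both orientations, when [a] and [b] vary;
    what remains is the Ricci contraction of the squared curvature operator. *)
Lemma ricci2_planes (R : comRingType) (H : nat -> nat -> R) (i j : 'I_4) :
  ricci2 (fun a b c d => plane_sign R a b * plane_sign R c d *
                         H (plane_index a b) (plane_index c d)) i j =
  2 * \sum_c plane_sign R c i * plane_sign R c j *
             plane_sqr H (plane_index c i) (plane_index c j).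
Proof.
have -> : ricci2 (fun a b c d => plane_sign R a b * plane_sign R c d *
                         H (plane_index a b) (plane_index c d)) i j =
  \sum_c plane_sign R c i * plane_sign R c j * \sum_a \sum_b
    plane_sign R a b ^+ 2 * (H (plane_index a b) (plane_index c i) *
                             H (plane_index a b) (plane_index c j)).
  rewrite /ricci2; under eq_bigr do rewrite exchange_big /=.
  rewrite exchange_big; apply: eq_bigr => c _ /=.
  rewrite big_distrr; apply: eq_bigr => a _ /=.
  rewrite big_distrr; apply: eq_bigr => b _ /=; ring.
rewrite big_distrr; apply: eq_bigr => c _ /=.
rewrite mulrCA; congr (_ * _); rewrite !sum4 /plane_sign /= /plane_sqr; ring.
Qed.

(** The isomorphism between operators from self-dual to anti-self-dual bivectors
    and traceless symmetric 2-tensors, applied to the off-diagonal block of the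
    squared curvature operator. *)
Lemma offblock_ricci2 (R : numDomainType)
    (K : 'I_4 -> 'I_4 -> 'I_4 -> 'I_4 -> R) : curvature_like K ->
  let r i j := ricci2 K i j in
  2 *: offblock K = \matrix_(i, j) nth 0 (nth [::]
    [:: [:: r (o 0) (o 0) + r (o 1) (o 1) - r (o 2) (o 2) - r (o 3) (o 3);
            2 * (r (o 1) (o 2) - r (o 0) (o 3));
            2 * (r (o 3) (o 1) + r (o 0) (o 2))];
        [:: 2 * (r (o 1) (o 2) + r (o 0) (o 3));
            r (o 0) (o 0) + r (o 2) (o 2) - r (o 1) (o 1) - r (o 3) (o 3);
            2 * (r (o 2) (o 3) - r (o 0) (o 1))];
        [:: 2 * (r (o 3) (o 1) - r (o 0) (o 2));
            2 * (r (o 2) (o 3) + r (o 0) (o 1));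
            r (o 0) (o 0) + r (o 3) (o 3) - r (o 1) (o 1) - r (o 2) (o 2)]] i) j.
Proof.
case/curvature_likeE => H Hs -> r.
apply/matrixP; do 2!elim/ord3E; 
  rewrite /r !ricci2_planes !sum4 !mxE /= !sum3 !mxE /=
  /plane_sign /= /plane_sqr;
  rewrite ?(Hs 1 0)%N ?(Hs 2 0)%N ?(Hs 3 0)%N ?(Hs 4 0)%N ?(Hs 5 0)%N
    ?(Hs 2 1)%N ?(Hs 3 1)%N ?(Hs 4 1)%N ?(Hs 5 1)%N
    ?(Hs 3 2)%N ?(Hs 4 2)%N ?(Hs 5 2)%N ?(Hs 4 3)%N ?(Hs 5 3)%N ?(Hs 5 4)%N.
all: ring.
Qed.

Lemma norm2_ricci2 (R : comRingType) (n : nat)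
    (K : 'I_n -> 'I_n -> 'I_n -> 'I_n -> R) :
  \sum_i \sum_j \sum_k \sum_l K i j k l ^+ 2 = \sum_l ricci2 K l l.
Proof.
rewrite /ricci2; under eq_bigr do under eq_bigr do rewrite exchange_big /=.
under eq_bigr do rewrite exchange_big /=.
by rewrite exchange_big.
Qed.

Lemma ricci2C (R : comRingType) (n : nat)
    (K : 'I_n -> 'I_n -> 'I_n -> 'I_n -> R) (i j : 'I_n) :
  ricci2 K i j = ricci2 K j i.
Proof.
by do 3 (apply: eq_bigr => ? _); rewrite mulrC.
Qed.

Lemma ricci2_pure_trace (R : realFieldType)
    (K : 'I_4 -> 'I_4 -> 'I_4 -> 'I_4 -> R) : curvature_like K ->
  (forall i j, ricci2 K i j =
     4^-1 * (\sum_i \sum_j \sum_k \sum_l K i j k l ^+ 2) * (i == j)%:R) <->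
  offblock K = 0.
Proof.
move=> Kc; have W := offblock_ricci2 Kc.
rewrite norm2_ricci2 sum4; split=> [|h].
  move: (X in 4^-1 * X) => N h.
  have two0 : (2 : R) != 0 by rewrite pnatr_eq0.
  apply: (scalerI two0); rewrite W scaler0; apply/matrixP.
  do 2!elim/ord3E; rewrite !mxE /= !(h, mulr0, mulr1) /=; ring.
rewrite h scaler0 in W.
have {W}w i j := esym (congr1 (fun A : 'M[R]_3 => A i j) W).
have := (w (p 0) (p 0), w (p 0) (p 1), w (p 0) (p 2), w (p 1) (p 0),
  w (p 1) (p 1), w (p 1) (p 2), w (p 2) (p 0), w (p 2) (p 1), w (p 2) (p 2)).
rewrite !mxE /= => -[[[[[[[[w00 w01] w02] w10] w11] w12] w20] w21] w22].
by do 2!elim/ord4E; rewrite /= ?mulr0 ?mulr1;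
  rewrite ?(ricci2C K (o 1) (o 0)) ?(ricci2C K (o 2) (o 0))
    ?(ricci2C K (o 3) (o 0)) ?(ricci2C K (o 2) (o 1))
    ?(ricci2C K (o 1) (o 3)) ?(ricci2C K (o 3) (o 2)); lra.
Qed.

Definition singer_thorpe (R : pzRingType)
    (K : 'I_4 -> 'I_4 -> 'I_4 -> 'I_4 -> R) : Prop :=
  [/\ forall i j k, i != k -> K i j j k = 0,
      K (o 0) (o 1) (o 0) (o 1) ^+ 2 = K (o 2) (o 3) (o 2) (o 3) ^+ 2,
      K (o 0) (o 2) (o 0) (o 2) ^+ 2 = K (o 1) (o 3) (o 1) (o 3) ^+ 2 &
      K (o 0) (o 3) (o 0) (o 3) ^+ 2 = K (o 1) (o 2) (o 1) (o 2) ^+ 2].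

(** The entries of the 6 x 6 curvature array that are neither diagonal nor
    between complementary planes are, up to sign, the R_ijjk with i <> k, and
    the off-diagonal entries of the blocks are signed sums of them.  When these
    vanish, each diagonal entry of A B + B D is twice a difference of squares of
    sectional curvatures of complementary planes. *)
Lemma singer_thorpe_blocks (R : realFieldType)
    (K : 'I_4 -> 'I_4 -> 'I_4 -> 'I_4 -> R) : curvature_like K ->
  singer_thorpe K <->
  [/\ is_diag_mx (block 1 1 K), is_diag_mx (block 1 (- 1) K),
      is_diag_mx (block (- 1) (- 1) K) & offblock K = 0].
Proof.
case/curvature_likeE => H Hs ->; rewrite /singer_thorpe.
have Ho := ((Hs 1 0, Hs 2 0, Hs 3 0, Hs 4 0, Hs 5 0),
  (Hs 2 1, Hs 3 1, Hs 4 1, Hs 5 1),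
  (Hs 3 2, Hs 4 2, Hs 5 2), (Hs 4 3, Hs 5 3), Hs 5 4)%N.
split=> [[g s1 s2 s3]|[/is_diag_mxP A /is_diag_mxP B /is_diag_mxP D W]].
  (* One instance for each of the twelve pairs of planes that share an axis. *)
  have z01 : H 0%N 1%N = 0.
    by have := g (o 1) (o 0) (o 2) isT; rewrite /plane_sign /= ?Ho; lra.
  have z02 : H 0%N 2%N = 0.
    by have := g (o 1) (o 0) (o 3) isT; rewrite /plane_sign /= ?Ho; lra.
  have z04 : H 0%N 4%N = 0.
    by have := g (o 0) (o 1) (o 3) isT; rewrite /plane_sign /= ?Ho; lra.
  have z05 : H 0%N 5%N = 0.
    by have := g (o 0) (o 1) (o 2) isT; rewrite /plane_sign /= ?Ho; lra.
  have z12 : H 1%N 2%N = 0.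
    by have := g (o 2) (o 0) (o 3) isT; rewrite /plane_sign /= ?Ho; lra.
  have z13 : H 1%N 3%N = 0.
    by have := g (o 0) (o 2) (o 3) isT; rewrite /plane_sign /= ?Ho; lra.
  have z15 : H 1%N 5%N = 0.
    by have := g (o 0) (o 2) (o 1) isT; rewrite /plane_sign /= ?Ho; lra.
  have z23 : H 2%N 3%N = 0.
    by have := g (o 0) (o 3) (o 2) isT; rewrite /plane_sign /= ?Ho; lra.
  have z24 : H 2%N 4%N = 0.
    by have := g (o 0) (o 3) (o 1) isT; rewrite /plane_sign /= ?Ho; lra.
  have z34 : H 3%N 4%N = 0.
    by have := g (o 2) (o 3) (o 1) isT; rewrite /plane_sign /= ?Ho; lra.
  have z35 : H 3%N 5%N = 0.
    by have := g (o 3) (o 2) (o 1) isT; rewrite /plane_sign /= ?Ho; lra.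
  have z45 : H 4%N 5%N = 0.
    by have := g (o 3) (o 1) (o 2) isT; rewrite /plane_sign /= ?Ho; lra.
  have z := (z01, z02, z04, z05, z12, z13, z15, z23, z24, z34, z35, z45).
  have {}s1 : H 0%N 0%N ^+ 2 = H 3 3 ^+ 2.
    by move: s1; rewrite /plane_sign /= !mul1r.
  have {}s2 : H 1%N 1%N ^+ 2 = H 4 4 ^+ 2.
    by move: s2; rewrite /plane_sign /= mulrNN !mul1r.
  have {}s3 : H 2 2 ^+ 2 = H 5 5 ^+ 2.
    by move: s3; rewrite /plane_sign /= !mul1r.
  split.
  1-3: by apply/is_diag_mxP; do 2!elim/ord3E; rewrite //= => _;
    rewrite !mxE /= /plane_sign /= ?Ho ?z; ring.
  apply/matrixP; do 2!elim/ord3E; rewrite !mxE /= !sum3 !mxE /= /plane_sign /=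
    ?Ho ?z.
  all: try by [ring|ring: s1|ring: s2|ring: s3].
(* For i <> j, the entries A i j, B i j, B j i and D i j are four signed sums of
   four entries of the 6 x 6 array, and they determine these entries. *)
have := (A (p 0) (p 1) isT, A (p 0) (p 2) isT, A (p 1) (p 2) isT).
have := (D (p 0) (p 1) isT, D (p 0) (p 2) isT, D (p 1) (p 2) isT).
have := (B (p 0) (p 1) isT, B (p 0) (p 2) isT, B (p 1) (p 2) isT,
         B (p 1) (p 0) isT, B (p 2) (p 0) isT, B (p 2) (p 1) isT).
rewrite !mxE /= /plane_sign /= ?Ho.
move=> [[[[[b1 b2] b3] b4] b5] b6] [[d1 d2] d3] [[a1 a2] a3].
have z01 : H 0%N 1%N = 0 by lra.
have z02 : H 0%N 2%N = 0 by lra.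
have z04 : H 0%N 4%N = 0 by lra.
have z05 : H 0%N 5%N = 0 by lra.
have z12 : H 1%N 2%N = 0 by lra.
have z13 : H 1%N 3%N = 0 by lra.
have z15 : H 1%N 5%N = 0 by lra.
have z23 : H 2%N 3%N = 0 by lra.
have z24 : H 2%N 4%N = 0 by lra.
have z34 : H 3%N 4%N = 0 by lra.
have z35 : H 3%N 5%N = 0 by lra.
have z45 : H 4%N 5%N = 0 by lra.
have z := (z01, z02, z04, z05, z12, z13, z15, z23, z24, z34, z35, z45).
have w i : offblock (fun a b c d => plane_sign R a b * plane_sign R c d *
    H (plane_index a b) (plane_index c d)) i i = 0 by rewrite W mxE.
have := (w (p 0), w (p 1), w (p 2)).
rewrite !mxE /= !sum3 !mxE /= /plane_sign /= ?Ho ?z => -[[w0 w1] w2].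
have two0 : (2 : R) != 0 by rewrite pnatr_eq0.
split.
- do 3!elim/ord4E; rewrite //= => _; rewrite ?Ho ?z; ring.
- by apply: (mulfI two0); apply/eqP; rewrite -subr_eq0 -w0; apply/eqP; ring.
- by apply: (mulfI two0); apply/eqP; rewrite -subr_eq0 -w1; apply/eqP; ring.
- by apply: (mulfI two0); apply/eqP; rewrite -subr_eq0 -w2; apply/eqP; ring.
Qed.

(** * Symmetry of second partial derivatives *)

Lemma is_derive_line (R : realType) (n : nat) (f : 'rV[R]_n -> R)
    (v w : 'rV[R]_n) (s : R) :
  derivable f (s *: v + w) v ->
  is_derive s 1 (fun s : R => f (s *: v + w)) ('D_v f (s *: v + w)).
Proof.
have E :
  (fun h : R => h^-1 *: ((f \o shift (s *: v + w)) (h *: v) -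
                         f (s *: v + w))) =
  (fun h : R => h^-1 *: (((fun s : R => f (s *: v + w)) \o shift s) (h *: 1) -
                         f (s *: v + w))).
  apply/funext => h /=; congr (_ *: (f _ - _)).
  by rewrite scalerDl -scalerA scale1r addrA.
by move=> df; split; rewrite /derivable /derive -E.
Qed.

Lemma mean_value_line (R : realType) (n : nat) (f : 'rV[R]_n -> R)
    (v w : 'rV[R]_n) (h : R) : 0 < h ->
  (forall s, 0 <= s <= h -> derivable f (s *: v + w) v) ->
  exists2 s, 0 <= s <= h &
    f (h *: v + w) - f w = h * 'D_v f (s *: v + w).
Proof.
move=> h0 df.
pose g s : R := f (s *: v + w); pose dg s : R := 'D_v f (s *: v + w).
have di s : s \in `[0, h]%R -> is_derive s 1 g (dg s).
  by rewrite in_itv /= => sh; apply: is_derive_line; apply: df.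
have dio s : s \in `]0, h[%R -> is_derive s 1 g (dg s).
  by move=> sh; apply: di; apply: subset_itv_oo_cc.
have cg : {within `[0, h], continuous g}.
  by apply: derivable_within_continuous => s /di [].
have [s sh E] := MVT_segment (ltW h0) dio cg.
exists s; first by move: sh; rewrite in_itv.
by move: E; rewrite /g scale0r add0r subr0 mulrC.
Qed.

(** The mean value theorem, applied along [u] to the difference of two
    translates of [f], then along [v]. *)
Lemma second_difference (R : realType) (n : nat) (f : 'rV[R]_n -> R)
    (u v x : 'rV[R]_n) (h : R) : 0 < h ->
  (forall s t, 0 <= s <= h -> 0 <= t <= h ->
     derivable f (s *: u + (t *: v + x)) u /\
     derivable ('D_u f) (s *: u + (t *: v + x)) v) ->
  exists s t, [/\ 0 <= s <= h, 0 <= t <= h &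
    f (h *: u + (h *: v + x)) - f (h *: u + x) - f (h *: v + x) + f x =
    h ^+ 2 * 'D_v ('D_u f) (s *: u + (t *: v + x))].
Proof.
move=> h0 df.
have h00 : 0 <= (0 : R) <= h by rewrite lexx ltW.
have hh : 0 <= h <= h by rewrite lexx ltW.
pose g y := f (h *: v + y) - f y.
have dg s : 0 <= s <= h -> is_derive (s *: u + x) u g
    ('D_u f (s *: u + (h *: v + x)) - 'D_u f (s *: u + x)).
  move=> sh; have [d1 _] := df s h sh hh; have [d0 _] := df s 0 sh h00.
  rewrite scale0r add0r in d0; apply: is_deriveB; last exact: derivableP.
  have -> : s *: u + (h *: v + x) = h *: v + (s *: u + x) by rewrite addrCA.
  rewrite addrCA in d1.
  have E : (fun k : R => k^-1 *: ((f \o shift (h *: v + (s *: u + x))) (k *: u)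
              - f (h *: v + (s *: u + x)))) =
    (fun k : R => k^-1 *: (((fun y => f (h *: v + y)) \o
                            shift (s *: u + x)) (k *: u)
              - f (h *: v + (s *: u + x)))).
    by apply/funext => k /=; congr (_ *: (f _ - _)); rewrite addrCA.
  by split; rewrite /derivable /derive -E.
have [|s sh Es] := @mean_value_line _ _ g u x h h0.
  by move=> s sh; have [] := dg s sh.
have [|t th Et] := @mean_value_line _ _ ('D_u f) v (s *: u + x) h h0.
  move=> t th; have [_] := df s t sh th.
  by rewrite (addrCA (s *: u) (t *: v) x).
exists s, t; split; [exact: sh|exact: th|].
have [_ dgs] := dg s sh.
have c1 : s *: u + (t *: v + x) = t *: v + (s *: u + x) := addrCA _ _ _.
have c2 : h *: v + (s *: u + x) = s *: u + (h *: v + x) := addrCA _ _ _.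
have c3 : h *: v + (h *: u + x) = h *: u + (h *: v + x) := addrCA _ _ _.
rewrite c1 expr2 -mulrA -Et c2 -dgs -Es /g c3.
by rewrite opprB [RHS]addrA [RHS]addrAC.
Qed.

(** The second difference of [f] along [u] and [v] is symmetric in [u] and [v],
    and by [second_difference] it is close to either mixed derivative. *)
Lemma derive_comm (R : realType) (n : nat) (f : 'rV[R]_n -> R)
    (u v x : 'rV[R]_n) :
  (\forall y \near x, [/\ derivable f y u, derivable f y v,
     derivable ('D_u f) y v & derivable ('D_v f) y u]) ->
  {for x, continuous ('D_v ('D_u f))} ->
  {for x, continuous ('D_u ('D_v f))} ->
  'D_v ('D_u f) x = 'D_u ('D_v f) x.
Proof.
move=> df cvu cuv; apply/eqP; rewrite -subr_eq0 -normr_le0.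
apply/ler_addgt0Pl => e e0; rewrite addr0.
have e20 : 0 < e / 2 by rewrite divr_gt0.
have : \forall y \near x, [/\ [/\ derivable f y u, derivable f y v,
     derivable ('D_u f) y v & derivable ('D_v f) y u],
     `|'D_v ('D_u f) x - 'D_v ('D_u f) y| < e / 2 &
     `|'D_u ('D_v f) x - 'D_u ('D_v f) y| < e / 2].
  have /cvgrPdist_lt/(_ _ e20) hvu := cvu.
  have /cvgrPdist_lt/(_ _ e20) huv := cuv.
  by apply: filterS3 df hvu huv => y d1 d2 d3; exact: And3 d1 d2 d3.
move=> /nbhs_ballP[r /= r0 Br].
pose c := `|u| + `|v| + 1.
have c0 : 0 < c by rewrite ltr_wpDl // addr_ge0.
(* Any s u + t v with 0 <= s, t <= h then has norm less than r. *)
pose h := r / (2 * c).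
have h0 : 0 < h by rewrite divr_gt0 // mulr_gt0.
have near_x s t : 0 <= s <= h -> 0 <= t <= h ->
    ball x r (s *: u + (t *: v + x)).
  move=> /andP[s0 sh] /andP[t0 th]; rewrite -ball_normE /= addrA opprD addrCA.
  rewrite subrr addr0.
  rewrite normrN (le_lt_trans (ler_normD _ _)) // !normrZ !ger0_norm //.
  have : s * `|u| + t * `|v| <= h * c.
    rewrite /c !mulrDr mulr1.
    have su := ler_wpM2r (normr_ge0 u) sh.
    have tv := ler_wpM2r (normr_ge0 v) th.
    by rewrite (le_trans (lerD su tv)) // lerDl ltW.
  move=> hc; apply: le_lt_trans hc _.
  have -> : h * c = r / 2 by rewrite /h; field; rewrite gt_eqF.
  by rewrite ltr_pdivrMr // mulr_natr mulr2n ltrDl.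
have [s [t [sh th E1]]] := @second_difference R n f u v x h h0
  (fun s t sh th => 
    let: And3 (And4 a _ b _) _ _ := Br _ (near_x s t sh th) in conj a b).
have near_x' s' t' : 0 <= s' <= h -> 0 <= t' <= h ->
    ball x r (s' *: v + (t' *: u + x)).
  by move=> sh' th'; rewrite addrCA; apply: near_x.
have [s' [t' [sh' th' E2]]] := @second_difference R n f v u x h h0
  (fun s t sh th => 
    let: And3 (And4 _ a _ b) _ _ := Br _ (near_x' s t sh th) in conj a b).
have [_ B1 _] := Br _ (near_x s t sh th).
have [_ _ B2] := Br _ (near_x' s' t' sh' th').
move: E1 E2 B1 B2; move: ('D_v _ (s *: u + _)) ('D_u _ (s' *: v + _)) => a b.
rewrite (addrCA (h *: v)) => E1 E2 B1 B2.
have ab : a = b.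
  have hn : h ^+ 2 != 0 by rewrite expf_neq0 // gt_eqF.
  by apply: (mulfI hn); rewrite -E1 -E2 [X in X + _]addrAC.
rewrite -ab in B2.
rewrite [X in `|X|](_ : _ =
  ('D_v ('D_u f) x - a) - ('D_u ('D_v f) x - a)); last first.
  by rewrite opprB addrA subrK.
apply: le_trans (ler_normB _ _) _; rewrite (splitr e).
by apply: lerD; [exact: ltW B1|exact: ltW B2].
Qed.

Lemma smooth_on_pderiv (R : realType) (n : nat) (U : set 'rV[R]_n)
    (f : 'rV[R]_n -> R) (i : 'I_n) :
  smooth_on U f -> smooth_on U (pderiv i f).
Proof.
by move=> fU s x Ux; have := fU (rcons s i) x Ux; rewrite foldr_rcons.
Qed.

Lemma smooth_on_derivable (R : realType) (n : nat) (U : set 'rV[R]_n)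
    (f : 'rV[R]_n -> R) (i : 'I_n) (x : 'rV[R]_n) :
  smooth_on U f -> U x -> derivable f x (delta_mx 0 i).
Proof. by move=> fU Ux; have [_] := fU [::] x Ux. Qed.

Lemma pderiv_comm (R : realType) (n : nat) (U : set 'rV[R]_n)
    (f : 'rV[R]_n -> R) (i j : 'I_n) (x : 'rV[R]_n) :
  open U -> smooth_on U f -> U x ->
  pderiv i (pderiv j f) x = pderiv j (pderiv i f) x.
Proof.
move=> oU fU Ux; apply: derive_comm.
- near=> y; have Uy : U y by near: y; exact: open_nbhs_nbhs.
  split.
  - exact: smooth_on_derivable fU Uy.
  - exact: smooth_on_derivable fU Uy.
  - exact: smooth_on_derivable (smooth_on_pderiv j fU) Uy.
  - exact: smooth_on_derivable (smooth_on_pderiv i fU) Uy.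
- by have [] := fU [:: i; j] x Ux.
- by have [] := fU [:: j; i] x Ux.
Unshelve. all: by end_near. Qed.

(** * The curvature tensor in coordinates *)

(** Laplace expansion along a row, by induction on the size. *)
Lemma derivable_det (R : realType) (V : normedModType R) (n : nat)
    (A : V -> 'M[R]_n) (x v : V) :
  (forall i j, derivable (fun y => A y i j) x v) ->
  derivable (fun y => \det (A y)) x v.
Proof.
elim: n A => [|n IH] A dA.
  have -> : (fun y => \det (A y)) = cst 1 by apply/funext => y; rewrite det_mx00.
  exact: derivable_cst.
have -> : (fun y => \det (A y)) = \sum_(j < n.+1) ((fun y => A y 0 j) *
    (cst ((-1) ^+ (0 + j)) * (fun y => \det (row' 0 (col' j (A y)))))).
  by apply/funext => y; rewrite (expand_det_row _ 0) fct_sumE.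
apply: derivable_sum => j; apply: derivableM; first exact: dA.
apply: derivableM; first exact: derivable_cst.
apply: IH => i k; rewrite (_ : (fun y => _) = (fun y => A y (lift 0 i) (lift j k))).
  exact: dA.
by apply/funext => y; rewrite !mxE.
Qed.

Lemma derivable_invmx (R : realType) (V : normedModType R) (n : nat)
    (A : V -> 'M[R]_n) (x v : V) :
  (forall i j, derivable (fun y => A y i j) x v) ->
  (\forall y \near x, A y \in unitmx) ->
  forall i j, derivable (fun y => invmx (A y) i j) x v.
Proof.
move=> dA uA i j.
pose f : V -> R := (fun y => (\det (A y))^-1) * (cst ((-1) ^+ (j + i)) *
  (fun y => \det (row' j (col' i (A y))))).
apply: (@near_eq_derivable _ _ _ f).
  near=> y; have Ay : A y \in unitmx by near: y.
  by rewrite /invmx Ay !mxE.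
apply: derivableM.
  apply: derivableV; last exact: derivable_det.
  by have := nbhs_singleton uA; rewrite unitmxE unitfE.
apply: derivableM; first exact: derivable_cst.
apply: derivable_det => k l.
rewrite (_ : (fun y => _) = (fun y => A y (lift j k) (lift i l))).
  exact: dA.
by apply/funext => y; rewrite !mxE.
Unshelve. all: by end_near. Qed.

Lemma cov_deriv_cst (R : realType) (n : nat) (G : 'rV[R]_n -> 'M[R]_n)
    (v w x : 'rV[R]_n) :
  cov_deriv G (fun=> v) (fun=> w) x =
  \row_k \sum_i \sum_j christoffel G k i j x * v 0 i * w 0 j.
Proof.
apply/rowP => k; rewrite !mxE big1 ?add0r // => i _.
by rewrite /pderiv derive_cst mulr0.
Qed.

Lemma lie_bracket_cst (R : realType) (n : nat) (v w x : 'rV[R]_n) :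
  lie_bracket (fun=> v) (fun=> w) x = 0.
Proof.
apply/rowP => k; rewrite !mxE big1 // => i _.
by rewrite /pderiv !derive_cst !mulr0 subr0.
Qed.

(** The component on the [k]-th coordinate field of the curvature of the
    [i]-th, [a]-th and [b]-th ones. *)
Definition riemann_up (R : realType) (n : nat) (G : 'rV[R]_n -> 'M[R]_n)
    (x : 'rV[R]_n) (i a b k : 'I_n) : R :=
  pderiv i (christoffel G k a b) x - pderiv a (christoffel G k i b) x +
  \sum_j (christoffel G k i j x * christoffel G j a b x -
          christoffel G k a j x * christoffel G j i b x).

Definition riemann (R : realType) (n : nat) (G : 'rV[R]_n -> 'M[R]_n)
    (x : 'rV[R]_n) (i a b l : 'I_n) : R :=
  \sum_k riemann_up G x i a b k * G x k l.

Lemma pderiv_sum2 (R : realType) (n : nat) (F : 'I_n -> 'I_n -> 'rV[R]_n -> R)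
    (c : 'I_n -> 'I_n -> R) (i : 'I_n) (x : 'rV[R]_n) :
  (forall a b, derivable (F a b) x (delta_mx 0 i)) ->
  pderiv i (fun y => \sum_a \sum_b F a b y * c a b) x =
  \sum_a \sum_b pderiv i (F a b) x * c a b.
Proof.
move=> dF; rewrite /pderiv.
rewrite (_ : (fun y => _) = \sum_a \sum_b (c a b *: F a b)); last first.
  apply/funext => y; rewrite fct_sumE; apply: eq_bigr => a _.
  by rewrite fct_sumE; apply: eq_bigr => b _; rewrite mulrC.
have dcF a b : derivable (c a b *: F a b) x (delta_mx 0 i).
  by apply: derivableZ; apply: dF.
rewrite derive_sum; last by move=> a; apply: derivable_sum => b; apply: dcF.
apply: eq_bigr => a _; rewrite derive_sum; last by move=> b; apply: dcF.
apply: eq_bigr => b _; rewrite deriveZ; last by apply: dF.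
by rewrite mulrC.
Qed.

Lemma cov_deriv2_cst (R : realType) (n : nat) (G : 'rV[R]_n -> 'M[R]_n)
    (u v w x : 'rV[R]_n) (k : 'I_n) :
  (forall k a b i, derivable (christoffel G k a b) x (delta_mx 0 i)) ->
  cov_deriv G (fun=> u) (cov_deriv G (fun=> v) (fun=> w)) x 0 k =
  \sum_i \sum_a \sum_b u 0 i * v 0 a * w 0 b *
    (pderiv i (christoffel G k a b) x +
     \sum_j christoffel G k i j x * christoffel G j a b x).
Proof.
move=> dG; rewrite mxE -big_split; apply: eq_bigr => i _ /=.
have -> : (fun y => cov_deriv G (fun=> v) (fun=> w) y 0 k) =
    (fun y => \sum_a \sum_b christoffel G k a b y * (v 0 a * w 0 b)).
  apply/funext => y; rewrite cov_deriv_cst mxE.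
  by apply: eq_bigr => a _; apply: eq_bigr => b _; rewrite mulrA.
rewrite pderiv_sum2; last by move=> a b; apply: dG.
have -> : \sum_j christoffel G k i j x * u 0 i *
      cov_deriv G (fun=> v) (fun=> w) x 0 j =
    \sum_a \sum_b u 0 i * v 0 a * w 0 b *
      (\sum_j christoffel G k i j x * christoffel G j a b x).
  rewrite cov_deriv_cst; under eq_bigr do rewrite mxE big_distrr /=.
  rewrite exchange_big; apply: eq_bigr => a _ /=.
  under eq_bigr do rewrite big_distrr /=.
  rewrite exchange_big; apply: eq_bigr => b _ /=.
  rewrite big_distrr; apply: eq_bigr => j _ /=; ring.
rewrite big_distrr -big_split; apply: eq_bigr => a _ /=.
rewrite big_distrr -big_split; apply: eq_bigr => b _ /=; ring.
Qed.

Lemma curvature_op_cst (R : realType) (n : nat) (G : 'rV[R]_n -> 'M[R]_n)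
    (u v w x : 'rV[R]_n) :
  (forall k a b i, derivable (christoffel G k a b) x (delta_mx 0 i)) ->
  curvature_op G (fun=> u) (fun=> v) (fun=> w) x =
  \row_k \sum_i \sum_a \sum_b
    u 0 i * v 0 a * w 0 b * riemann_up G x i a b k.
Proof.
move=> dG; apply/rowP => k; rewrite [RHS]mxE /curvature_op.
have sub3 (A B C : 'rV[R]_n) : (A - B - C) 0 k = A 0 k - B 0 k - C 0 k.
  by rewrite !mxE.
rewrite sub3 (@cov_deriv2_cst _ _ _ u v w x k dG).
rewrite (@cov_deriv2_cst _ _ _ v u w x k dG).
have -> : cov_deriv G (lie_bracket (fun=> u) (fun=> v)) (fun=> w) x 0 k = 0.
  rewrite mxE lie_bracket_cst big1 ?add0r => [|i _]; last by rewrite mxE mul0r.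
  by rewrite big1 // => i _; rewrite big1 // => j _; rewrite mxE mulr0 mul0r.
rewrite subr0 [X in _ - X]exchange_big -sumrB; apply: eq_bigr => i _ /=.
rewrite -sumrB; apply: eq_bigr => a _; rewrite -sumrB; apply: eq_bigr => b _ /=.
rewrite /riemann_up sumrB.
move: (pderiv i _ x) (pderiv a _ x) (\sum_j _) (\sum_j _) => d1 d2 s1 s2; ring.
Qed.

Lemma christoffel_derivable (R : realType) (n : nat)
    (G : 'rV[R]_n -> 'M[R]_n) (U : set 'rV[R]_n) (x : 'rV[R]_n) :
  open U -> U x -> (forall y, U y -> G y \in unitmx) ->
  (forall i j, smooth_on U (fun y => G y i j)) ->
  forall k a b i, derivable (christoffel G k a b) x (delta_mx 0 i).
Proof.
move=> oU Ux uG sG k a b i.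
have dG j l m y : U y -> derivable (pderiv m (fun y => G y j l)) y (delta_mx 0 i).
  by move=> Uy; exact: smooth_on_derivable (smooth_on_pderiv m (sG j l)) Uy.
rewrite (_ : christoffel G k a b = 2^-1 *: \sum_l
  ((fun y => invmx (G y) k l) * (pderiv a (fun y => G y b l) +
    pderiv b (fun y => G y a l) - pderiv l (fun y => G y a b)))); last first.
  by apply/funext => y; rewrite /christoffel; congr (_ * _); rewrite fct_sumE.
apply: derivableZ; apply: derivable_sum => l; apply: derivableM.
  apply: derivable_invmx => [j m|]; first exact: smooth_on_derivable (sG j m) Ux.
  near=> y; apply: uG; near: y; exact: open_nbhs_nbhs.
apply: derivableB; last exact: dG.
by apply: derivableD; exact: dG.
Unshelve. all: by end_near. Qed.

(** Christoffel symbols of the first kind. *)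
Definition christoffel_low (R : realType) (n : nat) (G : 'rV[R]_n -> 'M[R]_n)
    (a b l : 'I_n) (x : 'rV[R]_n) : R :=
  \sum_k christoffel G k a b x * G x k l.

Lemma pderiv_christoffel_low (R : realType) (n : nat)
    (G : 'rV[R]_n -> 'M[R]_n) (i a b l : 'I_n) (x : 'rV[R]_n) :
  (forall k a b i, derivable (christoffel G k a b) x (delta_mx 0 i)) ->
  (forall k l i, derivable (fun y => G y k l) x (delta_mx 0 i)) ->
  pderiv i (christoffel_low G a b l) x =
  \sum_k pderiv i (christoffel G k a b) x * G x k l +
  \sum_k christoffel G k a b x * pderiv i (fun y => G y k l) x.
Proof.
move=> dC dG; rewrite /pderiv.
rewrite (_ : christoffel_low G a b l =
    \sum_k (christoffel G k a b * (fun y => G y k l))); last first.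
  by apply/funext => y; rewrite fct_sumE.
rewrite derive_sum; last by move=> k; apply: derivableM; [exact: dC|exact: dG].
rewrite -big_split; apply: eq_bigr => k _ /=.
rewrite deriveM; [|exact: dC|exact: dG].
by rewrite addrC; congr (_ + _); rewrite mulrC.
Qed.

(** Christoffel symbols of the first kind involve the metric without its
    inverse, so their derivatives are second derivatives of the metric alone. *)
Lemma pderiv_christoffel_low2 (R : realType) (n : nat)
    (G : 'rV[R]_n -> 'M[R]_n) (U : set 'rV[R]_n) (i a b l : 'I_n)
    (x : 'rV[R]_n) :
  open U -> U x -> (forall y, U y -> (G y)^T = G y) ->
  (forall y, U y -> G y \in unitmx) ->
  (forall i j, smooth_on U (fun y => G y i j)) ->
  pderiv i (christoffel_low G a b l) x =
  2^-1 * (pderiv i (pderiv a (fun y => G y b l)) x +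
          pderiv i (pderiv b (fun y => G y a l)) x -
          pderiv i (pderiv l (fun y => G y a b)) x).
Proof.
move=> oU Ux Gs Gu sG.
have d2 m j k : derivable (pderiv m (fun y => G y j k)) x (delta_mx 0 i).
  exact: smooth_on_derivable (smooth_on_pderiv m (sG j k)) Ux.
pose f : 'rV[R]_n -> R := 2^-1 *: (pderiv a (fun y => G y b l) +
  pderiv b (fun y => G y a l) - pderiv l (fun y => G y a b)).
have -> : pderiv i (christoffel_low G a b l) x = pderiv i f x.
  apply: near_eq_derive; near=> y; have Uy : U y by near: y; exact: open_nbhs_nbhs.
  exact: christoffel_lower (Gs y Uy) (Gu y Uy).
have dab : derivable (pderiv a (fun y => G y b l) + pderiv b (fun y => G y a l)) x
    (delta_mx 0 i : 'rV[R]_n) by apply: derivableD; exact: d2.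
rewrite /pderiv deriveZ; last by apply: derivableB; [exact: dab|exact: d2].
by rewrite deriveB; [rewrite deriveD; [|exact: d2|exact: d2]|exact: dab|exact: d2].
Unshelve. all: by end_near. Qed.

(** The connection is compatible with the metric. *)
Lemma pderiv_metric_low (R : realType) (n : nat) (G : 'rV[R]_n -> 'M[R]_n)
    (i k l : 'I_n) (x : 'rV[R]_n) :
  (\forall y \near x, (G y)^T = G y) -> G x \in unitmx ->
  pderiv i (fun y => G y k l) x =
  christoffel_low G i k l x + christoffel_low G i l k x.
Proof.
move=> Gs Gu; have Gsx := nbhs_singleton Gs.
rewrite /christoffel_low !christoffel_lower //.
rewrite (pderiv_sym l k i Gs) (pderiv_sym i l k Gs) (pderiv_sym i k l Gs).
move: (pderiv i _ x) (pderiv k _ x) (pderiv l _ x) => d1 d2 d3.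
by field.
Qed.

(** Lowering the index inside the derivative turns the derivatives of the
    Christoffel symbols into second derivatives of the metric, at the price of
    derivatives of the metric, which [pderiv_metric_low] makes quadratic in the
    Christoffel symbols.  The symmetries of the curvature are visible on the
    resulting expression. *)
Lemma riemannE (R : realType) (n : nat) (G : 'rV[R]_n -> 'M[R]_n)
    (U : set 'rV[R]_n) (i a b l : 'I_n) (x : 'rV[R]_n) :
  open U -> U x -> (forall y, U y -> (G y)^T = G y) ->
  (forall y, U y -> G y \in unitmx) ->
  (forall i j, smooth_on U (fun y => G y i j)) ->
  let d2 i a b l := pderiv i (pderiv a (fun y => G y b l)) x in
  let T i a b l := \sum_k christoffel G k i a x * christoffel_low G b l k x in
  riemann G x i a b l =
  2^-1 * (d2 i b a l - d2 i l a b - d2 a b i l + d2 a l i b) +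
  (T i b a l - T a b i l).
Proof.
move=> oU Ux Gs Gu sG d2 T.
have nU : nbhs x U by exact: open_nbhs_nbhs.
have Gsx : \forall y \near x, (G y)^T = G y by apply: filterS nU => y; exact: Gs.
have dC := christoffel_derivable oU Ux Gu sG.
have dG k m j : derivable (fun y => G y k m) x (delta_mx 0 j).
  exact: smooth_on_derivable (sG k m) Ux.
pose S i' a' b' := \sum_k christoffel G k a' b' x * christoffel_low G i' k l x.
have low i' a' b' : \sum_k pderiv i' (christoffel G k a' b') x * G x k l =
    2^-1 * (d2 i' a' b' l + d2 i' b' a' l - d2 i' l a' b') -
    S i' a' b' - T a' b' i' l.
  have E1 := pderiv_christoffel_low i' a' b' l dC dG.
  have E2 := pderiv_christoffel_low2 i' a' b' l oU Ux Gs Gu sG.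
  have E3 : \sum_k christoffel G k a' b' x * pderiv i' (fun y => G y k l) x =
      S i' a' b' + T a' b' i' l.
    rewrite /S /T -big_split; apply: eq_bigr => k _ /=.
    rewrite -mulrDr; congr (_ * _).
    exact (pderiv_metric_low i' k l Gsx (Gu x Ux)).
  rewrite E1 E3 in E2; rewrite -E2; move: (T a' b' i' l) (S i' a' b') (\sum_k _).
  by move=> t s1 s2; rewrite -[RHS]addrA -opprD addrK.
have quad i' a' b' :
    \sum_k (\sum_j christoffel G k i' j x * christoffel G j a' b' x) * G x k l =
    S i' a' b'.
  rewrite /S; under eq_bigr do rewrite big_distrl /=.
  rewrite exchange_big; apply: eq_bigr => j _ /=.
  rewrite big_distrr; apply: eq_bigr => k _ /=.
  by rewrite mulrAC mulrC.
have d2C : d2 a i b l = d2 i a b l.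
  exact: pderiv_comm oU (sG b l) Ux.
have E : riemann G x i a b l =
    (\sum_k pderiv i (christoffel G k a b) x * G x k l -
     \sum_k pderiv a (christoffel G k i b) x * G x k l) +
    (\sum_k (\sum_j christoffel G k i j x * christoffel G j a b x) * G x k l -
     \sum_k (\sum_j christoffel G k a j x * christoffel G j i b x) * G x k l).
  rewrite -!sumrB -big_split; apply: eq_bigr => k _ /=.
  by rewrite /riemann_up sumrB mulrDl !mulrBl.
have {}E := etrans E (congr2 (fun p q => p + q)
  (congr2 (fun p q => p - q) (low i a b) (low a i b))
  (congr2 (fun p q => p - q) (quad i a b) (quad a i b))).
rewrite E d2C.
move: (d2 i a b l) (d2 i b a l) (d2 i l a b) (d2 a b i l) (d2 a l i b)
  (T a b i l) (T i b a l) (S i a b) (S a i b).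
by move=> x1 x2 x3 x4 x5 t1 t2 s1 s2; ring.
Qed.

Lemma riemann_curvature_like (R : realType) (n : nat)
    (G : 'rV[R]_n -> 'M[R]_n) (U : set 'rV[R]_n) (x : 'rV[R]_n) :
  open U -> U x -> (forall y, U y -> (G y)^T = G y) ->
  (forall y, U y -> G y \in unitmx) ->
  (forall i j, smooth_on U (fun y => G y i j)) ->
  curvature_like (riemann G x).
Proof.
move=> oU Ux Gs Gu sG.
have nU y : U y -> nbhs y U by move=> Uy; exact: open_nbhs_nbhs.
have Gsy y : U y -> \forall z \near y, (G z)^T = G z.
  by move=> Uy; apply: filterS (nU y Uy) => z; exact: Gs.
pose d2 i a b l := pderiv i (pderiv a (fun y => G y b l)) x.
pose T i a b l := \sum_k christoffel G k i a x * christoffel_low G b l k x.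
have d2C i a b l : d2 i a b l = d2 a i b l by exact: pderiv_comm oU (sG b l) Ux.
have d2S i a b l : d2 i a b l = d2 i a l b.
  apply: near_eq_derive; apply: filterS (nU x Ux) => y Uy.
  exact: pderiv_sym (Gsy y Uy).
have TC i a b l : T i a b l = T a i b l.
  apply: eq_bigr => k _; congr (_ * _).
  exact: christoffel_sym (Gsy x Ux).
have TS i a b l : T i a b l = T b l i a.
  rewrite /T /christoffel_low; under eq_bigr do rewrite big_distrr /=.
  under [RHS]eq_bigr do rewrite big_distrr /=.
  rewrite exchange_big; apply: eq_bigr => k _; apply: eq_bigr => m _ /=.
  have /matrixP/(_ k m) := Gs x Ux; rewrite mxE => ->.
  by rewrite mulrCA mulrA -mulrA.
have TC2 i a b l : T i a b l = T i a l b by rewrite TS TC TS.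
have E i a b l : riemann G x i a b l =
  2^-1 * (d2 i b a l - d2 i l a b - d2 a b i l + d2 a l i b) +
  (T i b a l - T a b i l) := riemannE i a b l oU Ux Gs Gu sG.
split=> i a b l; rewrite !E.
- move: (d2 i b a l) (d2 i l a b) (d2 a b i l) (d2 a l i b) (T i b a l)
    (T a b i l) => x1 x2 x3 x4 t1 t2; ring.
- rewrite (TS i l a b) (TS a l i b).
  move: (d2 i b a l) (d2 i l a b) (d2 a b i l) (d2 a l i b) (T i b a l)
    (T a b i l) => x1 x2 x3 x4 t1 t2; ring.
- rewrite (d2C b i l a) (d2S i b l a) (d2C b a l i) (d2S a b l i) (d2C l i b a).
  rewrite (d2S i l b a) (d2C l a b i) (d2S a l b i).
  rewrite (TC b i l a) (TC2 i b l a) (TS l i b a) (TC b a l i) (TC2 a b l i).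
  move: (d2 i b a l) (d2 i l a b) (d2 a b i l) (d2 a l i b) (T i b a l)
    (T a b i l) => x1 x2 x3 x4 t1 t2; ring.
Qed.

Lemma pullE (R : comPzRingType) (m n : nat) (E : 'M[R]_(m, n))
    (K : 'I_n -> 'I_n -> 'I_n -> 'I_n -> R) (i j k l : 'I_m) :
  pull E K i j k l =
  \sum_a \sum_b E i a * E j b * \sum_c \sum_d E k c * E l d * K a b c d.
Proof.
have dE i' j' a b : (E^T *m delta_mx i' j' *m E) a b = E i' a * E j' b.
  rewrite mxE (bigD1 j') //= big1 ?addr0 => [|j'' nj].
    rewrite mxE (bigD1 i') //= big1 ?addr0 => [|i'' ni].
      by rewrite !mxE !eqxx mulr1.
    by rewrite !mxE (negbTE ni) mulr0.
  by rewrite mxE big1 ?mul0r // => i'' _; rewrite !mxE (negbTE nj) andbF mulr0.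
apply: eq_bigr => a _; apply: eq_bigr => b _; rewrite dE; congr (_ * _).
by apply: eq_bigr => c _; apply: eq_bigr => d _; rewrite dE.
Qed.

(** The hypotheses of the coordinate computations hold for the metric in the
    chart chosen at a point. *)
Lemma chart_metric_facts (R : realType) (n : nat) (M : riemannianManifold R n)
    (p : M) (U := chart_at p @` chart_dom (chart_at p))
    (G := metric (chart_at p)) :
  [/\ open U, U (chart_at p p), forall y, U y -> (G y)^T = G y,
      forall y, U y -> G y \in unitmx &
      forall i j, smooth_on U (fun y => G y i j)].
Proof.
have ap := chart_at_atlas p; split.
- exact: chart_img_open.
- by exists p => //; exact: chart_at_dom.
- by move=> _ [q qp <-]; exact: (Defs.metric_sym ap qp).
- move=> _ [q qp <-]; rewrite unitmxE unitfE; apply/negP => /det0P[v v0 vG].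
  by have := metric_posdef ap qp v0; rewrite vG mul0mx mxE ltxx.
- by move=> i j; exact: metric_smooth ap i j.
Qed.

(** The curvature is tensorial: its value on a frame is multilinear in the
    coordinates of the frame. *)
Lemma Rcomp_pull (R : realType) (n : nat) (M : riemannianManifold R n) (p : M)
    (e : 'I_n -> tangent p) :
  Rcomp e = pull (\matrix_i e i) (riemann (metric (chart_at p)) (chart_at p p)).
Proof.
apply/funext => i; apply/funext => j; apply/funext => k; apply/funext => l.
have [oU Ux Gs Gu sG] := chart_metric_facts p.
rewrite pullE /Rcomp /inner /curvature curvature_op_cst; last first.
  exact: christoffel_derivable oU Ux Gu sG.
move: (metric _) (chart_at p p) => G x {oU Ux Gs Gu sG}.
rewrite mxE.
under eq_bigr do rewrite mxE big_distrl /=.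
under eq_bigr do under eq_bigr do rewrite mxE !big_distrl /=.
under eq_bigr do rewrite exchange_big /=.
rewrite exchange_big; apply: eq_bigr => a _ /=.
under eq_bigr do under eq_bigr do rewrite !big_distrl /=.
under eq_bigr do rewrite exchange_big /=.
rewrite exchange_big; apply: eq_bigr => b _ /=.
under eq_bigr do under eq_bigr do rewrite !big_distrl /=.
under eq_bigr do rewrite exchange_big /=.
rewrite exchange_big big_distrr; apply: eq_bigr => c _ /=.
rewrite big_distrr; apply: eq_bigr => d _ /=.
rewrite /riemann !big_distrr; apply: eq_bigr => m _ /=.
by rewrite !mxE; move: (riemann_up _ _ _ _ _ _) => r; ring.
Qed.

(** * From the blocks to the basis *)

Lemma block_tr (R : comPzRingType) (s t : R)
    (K : 'I_4 -> 'I_4 -> 'I_4 -> 'I_4 -> R) :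
  curvature_like K -> (block s t K)^T = block t s K.
Proof.
case=> _ _ K3; apply/matrixP => i j; rewrite !mxE.
have KC (P Q : 'I_4 * 'I_4) : K P.1 P.2 Q.1 Q.2 = K Q.1 Q.2 P.1 P.2 := K3 _ _ _ _.
rewrite (KC (plane j) (plane i)) (KC (coplane j) (plane i)).
rewrite (KC (plane j) (coplane i)) (KC (coplane j) (coplane i)); ring.
Qed.

(** If [E] induces [P] and [Q] on the two spaces of bivectors, then the blocks
    transform by [P] and [Q]. *)
Lemma block_pull (R : numDomainType) (K : 'I_4 -> 'I_4 -> 'I_4 -> 'I_4 -> R)
    (E : 'M[R]_4) (s t : R) (P Q : 'M[R]_3) :
  curvature_like K ->
  (forall i, E^T *m sdform s (delta_mx 0 i) *m E = sdform s (row i P)) ->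
  (forall i, E^T *m sdform t (delta_mx 0 i) *m E = sdform t (row i Q)) ->
  block s t (pull E K) = P *m block s t K *m Q^T.
Proof.
move=> Kc EP EQ; have four0 : (4 : R) != 0 by rewrite pnatr_eq0.
apply/matrixP => i j; apply: (mulfI four0).
have := biform_pull E K (sdform s (delta_mx 0 i)) (sdform t (delta_mx 0 j)).
rewrite EP EQ !biform_sdform //; last exact: curvature_like_pull.
by rewrite -!row1 -!row_mul -!mulmx_tr_dot mul1mx trmx1 mulmx1.
Qed.

Lemma orthonormal_basisE (R : realType) (n : nat) (M : riemannianManifold R n)
    (p : M) (e : 'I_n -> tangent p) :
  let F : 'M[R]_n := \matrix_i e i in
  orthonormal_basis e <->
  F *m metric (chart_at p) (chart_at p p) *m F^T = 1%:M.
Proof.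
move=> F; have FE i j : inner (e i) (e j) =
    (F *m metric (chart_at p) (chart_at p p) *m F^T) i j.
  rewrite /inner -[in LHS](rowK e i) -[in LHS](rowK e j) -/F -row_mul tr_row.
  by rewrite !mxE; apply: eq_bigr => k _; rewrite !mxE.
split=> [h|h i j]; last by rewrite FE h mxE.
by apply/matrixP => i j; rewrite -FE h mxE.
Qed.

(** In odd dimension, an orthogonal matrix or its opposite is a rotation. *)
Lemma special_orthogonal_scale (R : realType) (P : 'M[R]_3) :
  P *m P^T = 1%:M ->
  [/\ \det P * \det P = 1, (\det P *: P) *m (\det P *: P)^T = 1%:M &
      \det (\det P *: P) = 1].
Proof.
move=> PP; have dd : \det P * \det P = 1.
  by rewrite -[X in _ * X]det_tr -det_mulmx PP det1.
split=> //.
  by rewrite linearZ /= -scalemxAl -scalemxAr PP scalerA dd scale1r.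
by rewrite detZ !exprS expr0 mulr1 mulrCA -!mulrA dd mulr1 dd.
Qed.

Lemma is_diag_scale (R : pzRingType) (n : nat) (a : R) (X : 'M[R]_n) :
  is_diag_mx X -> is_diag_mx (a *: X).
Proof.
by move=> /is_diag_mxP Xd; apply/is_diag_mxP => i j ij; rewrite mxE Xd ?mulr0.
Qed.

(** Diagonalize the blocks by rotations of the two spaces of bivectors, and lift
    these rotations to a rotation of the tangent space. *)
Lemma singer_thorpe_frame (R : realType)
    (K : 'I_4 -> 'I_4 -> 'I_4 -> 'I_4 -> R) :
  curvature_like K -> offblock K = 0 ->
  exists2 E : 'M[R]_4, E *m E^T = 1%:M & singer_thorpe (pull E K).
Proof.
move=> Kc K0; have Ws := addr0_eq K0.
have [|||P [Q [PP QQ PA PB QD]]] :=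
  @simultaneous_diagonalization _ _ (block 1 1 K) (block 1 (- 1) K)
    (block (- 1) (- 1) K).
- exact: block_tr.
- exact: block_tr.
- by rewrite -Ws opprK.
have [_ PP1 dP] := special_orthogonal_scale PP.
have [_ QQ1 dQ] := special_orthogonal_scale QQ.
have [E [EE EP EQ]] := so3_pair_lift PP1 dP QQ1 dQ.
exists E => //; apply/singer_thorpe_blocks; first exact: curvature_like_pull.
have conj (a b : R) (S T X : 'M[R]_3) :
    (a *: S) *m X *m (b *: T)^T = (a * b) *: (S *m X *m T^T).
  by rewrite linearZ /= -scalemxAl -scalemxAr -scalemxAl scalerA mulrC.
have PtP := mulmx1C PP1; have QtQ := mulmx1C QQ1.
rewrite /offblock !(block_pull Kc EP EP) !(block_pull Kc EP EQ).
rewrite !(block_pull Kc EQ EQ).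
split; try by rewrite conj; exact: is_diag_scale.
move: (\det P *: P) (\det Q *: Q) PtP QtQ => P1 Q1 PtP QtQ.
rewrite !mulmxA -(mulmxA _ P1^T P1) -(mulmxA _ Q1^T Q1) PtP QtQ !mulmx1.
by rewrite -mulmxDl -!(mulmxA P1) -mulmxDr -/(offblock K) K0 mulmx0 mul0mx.
Qed.

Theorem theoremB (R : realType) (M : riemannianManifold R 4) :
  weakly_einstein M <->
  forall p : M, exists e : 'I_4 -> tangent p, generalized_singer_thorpe e.
Proof.
have Kc (p : M) (e : 'I_4 -> tangent p) : curvature_like (Rcomp e).
  have [oU Ux Gs Gu sG] := chart_metric_facts p.
  rewrite Rcomp_pull; apply: curvature_like_pull.
  exact: riemann_curvature_like oU Ux Gs Gu sG.
have gst (p : M) (e : 'I_4 -> tangent p) :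
    generalized_singer_thorpe e <->
    orthonormal_basis e /\ singer_thorpe (Rcomp e).
  have l0 : 0 = o 0 by apply/val_inj.
  have l1 : 1 = o 1 by apply/val_inj.
  have l2 : 2 = o 2 by apply/val_inj.
  have l3 : 3 = o 3 by apply/val_inj.
  rewrite /generalized_singer_thorpe /singer_thorpe l3 l2 l1 l0.
  by split=> [[? ? ? ? ?]|[? [? ? ? ?]]].
split=> h p.
  have [e [oe we]] := h p.
  have K0 := (ricci2_pure_trace (Kc p e)).1 we.
  have [E EE ste] := singer_thorpe_frame (Kc p e) K0.
  exists (fun i => row i (E *m \matrix_i e i)); apply/gst.
  have rE : \matrix_i row i (E *m \matrix_i e i) = E *m \matrix_i e i.
    by apply/row_matrixP => i; rewrite rowK.
  split.
    apply/orthonormal_basisE; rewrite rE trmx_mul !mulmxA.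
    move/orthonormal_basisE: oe => oe.
    by rewrite -(mulmxA E) -(mulmxA E) oe mulmx1.
  by rewrite Rcomp_pull rE -pull_mul -Rcomp_pull.
have [e /gst[oe ste]] := h p; exists e; split=> //.
have [_ _ _ K0] := (singer_thorpe_blocks (Kc p e)).1 ste.
exact: (ricci2_pure_trace (Kc p e)).2 K0.
Qed.
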